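(* Let $\mathcal{R}$ be a class of ranking rules of finite VC dimension $V$ such that the associated class of functions $\mathcal{F}_B$ is rich in the sense that $$\lim_{B\to\infty}\inf_{f\in\mathcal{F}_B}A(f)=A^*$$ for all distributions of $(X,Y)$. Then if $f_n$ is defined as the empirical minimizer of $A_n(f)$ over $\mathcal{F}_{B_n}$, where the sequence $B_n$ satisfies $B_n\to\infty$ and $B_n^2\,\phi'(B_n)/\sqrt n\to0$, $$\lim_{n\to\infty}L(f_n)=L^*\quad\text{almost surely.}$$
   Context: Let $\mathcal{X}$ be a measurable space, $(X,Y)$ a random pair in $\mathcal{X}\times\mathbb{R}$, $(X',Y')$ an independent copy, $Z=(Y-Y')/2$, and $(X_1,Y_1),(X_2,Y_2),\dots$ i.i.d. copies of $(X,Y)$, with $Z_{i,j}=(Y_i-Y_j)/2$. A ranking rule is a function $r:\mathcal{X}\times\mathcal{X}\to\{-1,1\}$; its risk is $L(r)=\mathbb{P}\{Z\cdot r(X,X')<0\}$, and $L^*$ is the minimum of $L(r)$ over all ranking rules. The VC dimension of $\mathcal{R}$ is that of the class of sets $\{(x,x'):r(x,x')=1\}$, $r\in\mathcal{R}$. A measurable $f:\mathcal{X}\times\mathcal{X}\to\mathbb{R}$ induces the ranking rule equal to $1$ if $f(x,x')>0$ and $-1$ otherwise; $L(f)$ denotes the risk of this induced rule. For the data-dependent $f_n$, $L(f_n)$ is the conditional risk given $(X_i,Y_i)_{i\le n}$, with $(X,Y),(X',Y')$ independent of the data. $\phi:\mathbb{R}\to[0,\infty)$ is a convex cost function satisfying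 $\phi(0)=1$ and $\phi(x)\ge\mathbb{I}_{[x\ge0]}$ (e.g. $e^x$, $\log_2(1+e^x)$, $(1+x)_+$), where $\mathbb{I}$ is the indicator, and $\phi'$ is its derivative (right derivative where $\phi$ is not differentiable). With $\mathrm{sgn}(x)=1,-1,0$ for $x>0$, $x<0$, $x=0$ respectively, the cost functional is $A(f)=\mathbb{E}\,\phi(-\mathrm{sgn}(Z)\cdot f(X,X'))$, $A^*=\inf_fA(f)$ over all measurable $f:\mathcal{X}\times\mathcal{X}\to\mathbb{R}$, and the empirical cost functional is $A_n(f)=\frac1{n(n-1)}\sum_{i\ne j}\phi(-\mathrm{sgn}(Z_{i,j})\cdot f(X_i,X_j))$. The empirical minimizer of $A_n$ over a class $\mathcal{F}$ is a minimizer $f_n\in\mathcal F$ of $A_n$ or, if the minimum does not exist, any $f_n\in\mathcal{F}$ with $A_n(f_n)\le\inf_{f\in\mathcal{F}}A_n(f)+1/n$. For $B>0$, $$\mathcal{F}_B=\Big\{f(x,x')=\sum_{j=1}^Nw_jg_j(x,x'):\ N\in\mathbb{N},\ w_j\in\mathbb{R},\ \sum_{j=1}^N|w_j|=B,\ g_j\in\mathcal{R}\Big\}.$$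
   Formalization: The cost φ is additionally assumed differentiable at 0 with φ'(0)>0 (the claim fails e.g. for φ≡1, or for φ with a kink at 0), and f_n is assumed jointly measurable in the data and (x,x'), so that the conditional risk L(f_n) is defined. *)

(* Defs.v *)
From HB Require Import structures.
From mathcomp Require Import all_boot all_order all_algebra finmap.
From mathcomp Require Import all_classical all_reals all_analysis.

Set Implicit Arguments.
Unset Strict Implicit.
Unset Printing Implicit Defensive.

Import Order.TTheory GRing.Theory Num.Theory.
Import numFieldNormedType.Exports.

Local Open Scope classical_set_scope.
Local Open Scope card_scope.
Local Open Scope ring_scope.

Section VCDimension.
Context {T : Type}.

Definition shatters (C : set (set T)) (A : set T) : Prop :=
  forall S : set T, S `<=` A -> exists2 c, C c & A `&` c = S.

(* V is the largest cardinality of a finite set shattered by C. *)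
Definition has_VC_dimension (C : set (set T)) (V : nat) : Prop :=
  (exists A : set T, A #= `I_V /\ shatters C A) /\
  (forall (A : set T) (k : nat), A #= `I_k -> shatters C A -> (k <= V)%N).

End VCDimension.

Definition iid {d d' : measure_display} {Omega : measurableType d}
    {T : measurableType d'} {R : realType} (P : probability Omega R)
    (mu : probability T R) (D : nat -> {RV P >-> T}) : Prop :=
  (forall (i : nat) (E : set T), measurable E -> distribution P (D i) E = mu E)
  /\
  (forall (J : {fset nat}) (E : nat -> set T),
    (forall i, measurable (E i)) ->
    P (\bigcap_(i in [set` J]) (D i @^-1` E i)) =
      (\prod_(i <- J) P (D i @^-1` E i))%E).

Definition right_derivative {R : realType} (phi : R -> R) (x : R) : R :=
  lim (h^-1 * (phi (x + h) - phi x) @[h --> 0^'+]).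

Section Ranking.
Context {d : measure_display} {X : measurableType d} {R : realType}.

Definition ranking_rule (r : X * X -> R) : Prop :=
  measurable_fun setT r /\ forall q, r q = 1 \/ r q = -1.

Definition rule_sets (Rs : set (X * X -> R)) : set (set (X * X)) :=
  [set [set q | r q = 1] | r in Rs].

Definition half_diff (z z' : X * R) : R := (z.2 - z'.2) / 2.

(* mu is the law of (X, Y), so mu \x mu is the law of ((X, Y), (X', Y')). *)
Definition risk (mu : probability (X * R)%type R) (r : X * X -> R) : \bar R :=
  (mu \x mu)%E [set p | half_diff p.1 p.2 * r (p.1.1, p.2.1) < 0].

Definition optimal_risk (mu : probability (X * R)%type R) : \bar R :=
  ereal_inf [set risk mu r | r in ranking_rule].

Definition induced_rule (f : X * X -> R) (q : X * X) : R :=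
  if 0 < f q then 1 else -1.

Definition cost (mu : probability (X * R)%type R) (phi : R -> R)
    (f : X * X -> R) : \bar R :=
  (\int[mu \x mu]_p
    (phi (- Num.sg (half_diff p.1 p.2) * f (p.1.1, p.2.1)))%:E)%E.

Definition optimal_cost (mu : probability (X * R)%type R) (phi : R -> R)
    : \bar R :=
  ereal_inf [set cost mu phi f | f in [set f | measurable_fun setT f]].

Definition empirical_cost (phi : R -> R) (n : nat) (s : n.-tuple (X * R))
    (f : X * X -> R) : R :=
  (n%:R * (n%:R - 1))^-1 *
  \sum_(i < n) \sum_(j < n | j != i)
    phi (- Num.sg (half_diff (tnth s i) (tnth s j)) *
         f ((tnth s i).1, (tnth s j).1)).

Definition combinations (Rs : set (X * X -> R)) (B : R) : set (X * X -> R) :=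
  [set f | exists (N : nat) (w : 'I_N -> R) (g : 'I_N -> X * X -> R),
    [/\ \sum_(j < N) `|w j| = B,
        forall j, Rs (g j) &
        f = fun q => \sum_(j < N) w j * g j q]].

Definition minimizer (phi : R -> R) (n : nat) (s : n.-tuple (X * R))
    (F : set (X * X -> R)) (f : X * X -> R) : Prop :=
  F f /\ forall g, F g -> empirical_cost phi s f <= empirical_cost phi s g.

Definition empirical_minimizer (phi : R -> R) (n : nat)
    (s : n.-tuple (X * R)) (F : set (X * X -> R)) (f : X * X -> R) : Prop :=
  minimizer phi s F f \/
  [/\ ~ (exists g, minimizer phi s F g), F f &
      empirical_cost phi s f <=
        inf [set empirical_cost phi s g | g in F] + n%:R^-1].

End Ranking.

(* Main.v *)
(* Truncate the loss: with Phi = phi o trunc T one has Phi <= phi + e for T large,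
   f and trunc T o f induce the same rule, and calibration (compare f with
   the function equal to a small multiple of the Bayes rule where f has the wrong
   sign) shows that L(f) is close to L^* as soon as the expected cost of
   trunc T o f is close to A^*. So it suffices to control, for the fixed bounded
   Lipschitz loss Phi, the deviation of the expected loss of f_n above its
   empirical loss, together with the deviation of A_n(g) above A(g) for one fixed g.

   For the deviation, a ghost sample and Jensen's inequality bound the
   exponential moment by an average over the exchanges of X_i with its copy, the
   2n points being fixed. Since f_n is inserted before the exchange, no supremum
   over the class has to be measurable. Sampling k ~ B_n^2 rules from the weights of
   f (Maurey) replaces f by an average of k rules, up to a small error; by
   Sauer-Shelah there are at most (2 (4n^2+1)^V)^k such averages on the 2n points,
   and for each of them the bounded differences inequality on the cube applies.
   The hypothesis on B_n gives B_n^2 = O(sqrt n) because phi'(B_n) >= phi'(0) > 0, so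
   the tails exp(- c n + O(n^(3/4))) are summable. As T is fixed along the
   sequence, neither the growth of phi(B_n) nor that of phi'(B_n) enters. *)

Require Import Defs.
From mathcomp Require Import all_boot all_order all_algebra finmap.
From mathcomp Require Import all_classical all_reals all_analysis measurable_realfun.
From mathcomp Require Import ring lra.

Import Order.TTheory GRing.Theory Num.Theory.
Import numFieldNormedType.Exports.

Set Implicit Arguments.
Unset Strict Implicit.
Unset Printing Implicit Defensive.

Local Open Scope classical_set_scope.
Local Open Scope ring_scope.

(** * Convex cost functions *)

(** Why truncate: on combinations with total weight [B n] the loss [phi] ranges up to [phi (B n)],
    so bounded differences would leave an exponent of order [n / phi (B n) ^ 2]. The rate hypothesis
    directly gives only that this ratio tends to infinity, whereas Borel-Cantelli asks for a rate.
    The truncated loss has a range [M] and a Lipschitz constant [L] that do not depend on [n]. Why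
    truncating is cheap: right of [T] the cost is nondecreasing, and far to the left a nonnegative
    convex function cannot fall more than [e] below its value at [- T], even if it increases again.
    Only upper deviations are needed, since no rule has risk below the optimal one. Maurey's
    averages need not approximate f uniformly. For each exchange of the samples it is enough that
    one average has a deviation as large as that of f up to a fixed error; the exponential is then
    bounded by the sum over all averages, whose kernels no longer depend on the exchange. *)

Definition convexR (R : realType) (phi : R -> R) := forall x y t : R,
  0 <= t <= 1 -> phi (t * x + (1 - t) * y) <= t * phi x + (1 - t) * phi y.

Lemma convex_function_convexR (R : realType) (phi : R -> R) :
  convex_function (setT : set R^o) phi -> convexR phi.
Proof.
move=> cphi x y t /andP[t0 t1].
pose ti : {i01 R} := Itv01 t0 t1.
by have := cphi ti x y; rewrite !inE !convRE; apply.
Qed.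

Section ConvexCost.
Context {R : realType} (phi : R -> R).
Context (phi_ge0 : forall x, 0 <= phi x) (phi_cvx : convexR phi)
  (phi0 : phi 0 = 1) (dphi : derivable phi 0 1).

Local Notation c := (derive1 phi 0).

Let frac01 (a b : R) : 0 <= a -> a <= b -> 0 < b -> 0 <= a / b <= 1.
Proof.
by move=> a0 ab b0; rewrite divr_ge0 ?(ltW b0)//= ler_pdivrMr// mul1r.
Qed.

Lemma derive_epsilon e : 0 < e ->
  exists2 delta, 0 < delta &
    forall h, `|h| < delta -> `|phi h - 1 - c * h| <= e * `|h|.
Proof.
move=> e0.
have : h^-1 *: (phi (h *: 1 + 0) - phi 0) @[h --> 0^'] --> c.
  by rewrite derive1E; exact: dphi.
move/cvgrPdist_le => /(_ _ e0).
rewrite near_withinE => /nbhs_ballP[d /= d0 H].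
exists d => // h hd.
have [->|h0] := eqVneq h 0; first by rewrite phi0 mulr0 !subr0 subrr normr0 mulr0.
have := H h; rewrite /ball/= sub0r normrN => /(_ hd h0).
rewrite phi0 addr0 /GRing.scale/= mulr1 => le.
rewrite (_ : _ - c * h = - ((c - h^-1 * (phi h - 1)) * h)); last by field.
by rewrite normrN normrM ler_wpM2r.
Qed.

(** The chord from 0 to [x] lies above the graph at [t * x], and differentiability at 0 puts
    [phi (t * x)] above [1 + c * t * x] up to [o(t)]; divide by [t]. *)
Lemma convex_tangent x : 1 + c * x <= phi x.
Proof.
apply/ler_addgt0Pr => e e0.
have e1 : 0 < e / (`|x| + 1) by rewrite divr_gt0// ltr_wpDl.
have [d d0 H] := derive_epsilon e1.
pose t := Num.min 1 (d / (`|x| + 1) / 2).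
have x1 : 0 < `|x| + 1 by rewrite ltr_wpDl.
have t0 : 0 < t by rewrite lt_min ltr01/= !divr_gt0.
have t1 : t <= 1 by rewrite ge_min lexx.
have td : t * (`|x| + 1) < d.
  have : t <= d / (`|x| + 1) / 2 by rewrite ge_min lexx orbT.
  rewrite -(ler_pM2r x1) => /le_lt_trans; apply.
  by rewrite mulrAC divfK ?gt_eqF// ltr_pdivrMr// ltr_pMr// ltr1n.
have tx : `|t * x| = t * `|x| by rewrite normrM gtr0_norm.
have td' : t * `|x| < d by nra.
have {}H : `|phi (t * x) - 1 - c * (t * x)| <= e / (`|x| + 1) * (t * `|x|).
  by rewrite -tx; apply: H; rewrite tx.
have := @phi_cvx x 0 t; rewrite mulr0 addr0 phi0 mulr1 (ltW t0) t1 => /(_ isT) C.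
have E : e / (`|x| + 1) * (t * `|x|) <= e * t.
  rewrite (_ : _ * _ = e * t * (`|x| / (`|x| + 1))); last by ring.
  by rewrite ler_piMr ?mulr_ge0 ?ltW// ltr_pdivrMr// mul1r ltrDl.
move: H; rewrite ler_norml => /andP[H _].
have : t * (1 + c * x) <= t * (phi x + e) by nra.
by rewrite ler_pM2l.
Qed.

(** Prices a small multiple [a] of a sign rule to first order, whichever sign occurs; the comparison
    function in [calibration] is built from this [a]. *)
Lemma derive_small_step e : 0 < e -> exists2 a, 0 < a &
  phi a <= 1 + c * a + e * a /\ phi (- a) <= 1 - c * a + e * a.
Proof.
move=> e0; have [d d0 H] := derive_epsilon e0.
have d2 : 0 < d / 2 by rewrite divr_gt0.
exists (d / 2) => //.
have nd : `|d / 2| < d by rewrite gtr0_norm// ltr_pdivrMr// ltr_pMr// ltr1n.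
have := H _ nd; rewrite ler_norml gtr0_norm// => /andP[_ H1].
have := H (- (d / 2)); rewrite normrN => /(_ nd).
rewrite ler_norml gtr0_norm// => /andP[_ H2].
by split; lra.
Qed.

(** For [x < y] the slope on [[x, y]] lies between the slope from [- T - 1] to [y] and the slope
    from [x] to [T + 1]. Both segments have length at least 1 and [phi] is nonnegative, so the
    values at the two outer points bound these slopes. *)
Lemma convex_lipschitz T x y : - T <= x <= T -> - T <= y <= T ->
  `|phi x - phi y| <= (phi (T + 1) + phi (- T - 1)) * `|x - y|.
Proof.
wlog xy : x y / x <= y.
  move=> W xT yT; have [xy|/ltW yx] := leP x y; first exact: W.
  by rewrite distrC (distrC x); exact: W.
move=> /andP[Tx xT] /andP[Ty yT].
have [->|xney] := eqVneq x y; first by rewrite !subrr normr0 mulr0.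
have {xney}xy : x < y by rewrite lt_neqAle xney.
have yx0 : 0 < y - x by rewrite subr_gt0.
have d1 : 0 < T + 1 - x by lra.
have d2 : 0 < y + T + 1 by lra.
have up : phi y - phi x <= phi (T + 1) * (y - x).
  have := @phi_cvx (T + 1) x ((y - x) / (T + 1 - x)).
  rewrite (_ : _ * (T + 1) + _ = y); last by field; rewrite gt_eqF.
  have yTx : y - x <= T + 1 - x by lra.
  move=> /(_ (frac01 (ltW yx0) yTx d1))  C.
  have t1 : (y - x) / (T + 1 - x) <= y - x.
    by rewrite ler_pdivrMr// ler_peMr ?ltW//; lra.
  have t0 : 0 <= (y - x) / (T + 1 - x) by rewrite divr_ge0 ?ltW.
  have := phi_ge0 x; have := phi_ge0 (T + 1); nra.
have dn : phi x - phi y <= phi (- T - 1) * (y - x).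
  have := @phi_cvx (- T - 1) y ((y - x) / (y + T + 1)).
  rewrite (_ : _ * (- T - 1) + _ = x); last by field; rewrite gt_eqF.
  have yTx : y - x <= y + T + 1 by lra.
  move=> /(_ (frac01 (ltW yx0) yTx d2))  C.
  have t1 : (y - x) / (y + T + 1) <= y - x.
    by rewrite ler_pdivrMr// ler_peMr ?ltW//; lra.
  have t0 : 0 <= (y - x) / (y + T + 1) by rewrite divr_ge0 ?ltW.
  have := phi_ge0 y; have := phi_ge0 (- T - 1); nra.
rewrite (distrC x) (gtr0_norm yx0) ler_norml.
have := phi_ge0 (T + 1); have := phi_ge0 (- T - 1).
by move=> *; apply/andP; split; nra.
Qed.

Context (c0 : 0 < c).

(** The point [x] lies between 0 and [y], and [phi 0 = 1 <= phi y] by the tangent of positive slope,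
    so the chord is at most [phi y] at [x]. *)
Lemma cost_nondecreasing x y : 0 <= x -> x <= y -> phi x <= phi y.
Proof.
move=> x0; rewrite le_eqVlt => /orP[/eqP->//|xy].
have y0 : 0 < y by exact: le_lt_trans xy.
have := @phi_cvx y 0 (x / y).
rewrite mulr0 addr0 divfK ?gt_eqF// phi0.
have xy01 := frac01 x0 (ltW xy) y0.
move=> /(_ xy01); have := convex_tangent y; move: xy01 => /andP[? ?] ? ?.
have : 0 <= c * y by rewrite mulr_ge0// ltW.
nra.
Qed.

(** [phi] may increase again towards minus infinity. Let [- T0] nearly minimize [phi] over the
    negative axis: [- T] lies between [- t] and [- T0], and the chord stays below [phi (- t) + e]
    because [phi (- T0) <= phi (- t) + e]. *)
Lemma cost_left_tail e : 0 < e -> exists2 T0, 0 < T0 &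
  forall T t, T0 <= T -> T <= t -> phi (- T) <= phi (- t) + e.
Proof.
move=> e0; pose A := [set phi (- t) | t in [set t : R | 0 < t]].
have hA : has_inf A.
  split; first by exists (phi (-1)), 1 => //=.
  by exists 0 => _ [t _ <-].
have [_ [T0 /= T00 <-] lt] := inf_adherent e0 hA.
exists T0 => // T t T0T Tt.
have t0 : 0 < t by apply: lt_le_trans Tt; exact: lt_le_trans T0T.
have inft : inf A <= phi (- t) by apply: (inf_lbound (proj2 hA)); exists t.
have [E|ne] := eqVneq t T0.
  have -> : T = t by apply/eqP; rewrite eq_le Tt E.
  by rewrite lerDl ltW.
have Tt0 : 0 < t - T0.
  by rewrite subr_gt0 lt_neqAle eq_sym ne (le_trans T0T).
have := @phi_cvx (- t) (- T0) ((T - T0) / (t - T0)).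
rewrite (_ : _ * - t + _ = - T); last by field; rewrite gt_eqF.
have th : 0 <= (T - T0) / (t - T0) <= 1.
  by apply: frac01; rewrite ?subr_ge0 ?lerD2r.
move=> /(_ th); move/andP: th => [? ?].
nra.
Qed.

End ConvexCost.

(** * Truncation of the loss *)

Definition trunc (R : realType) (T x : R) := Num.max (- T) (Num.min x T).

Lemma trunc_in (R : realType) (T x : R) : 0 <= T -> - T <= trunc T x <= T.
Proof.
move=> T0; have TT : - T <= T by lra.
by rewrite /trunc le_max lexx/= ge_max TT/= ge_min lexx orbT.
Qed.

Lemma trunc_id (R : realType) (T x : R) : - T <= x <= T -> trunc T x = x.
Proof. by move=> /andP[Tx xT]; rewrite /trunc min_l// max_r. Qed.

Variant trunc_spec (R : realType) (T x : R) : R -> Type :=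
  | TruncLow of x <= - T : trunc_spec T x (- T)
  | TruncHigh of T <= x : trunc_spec T x T
  | TruncIn of - T <= x & x <= T : trunc_spec T x x.

Lemma truncP (R : realType) (T x : R) : 0 <= T -> trunc_spec T x (trunc T x).
Proof.
move=> T0; rewrite /trunc; case: (leP x T) => xT.
  by case: (leP (- T) x) => Tx; [exact: TruncIn|apply: TruncLow; exact: ltW].
by rewrite max_r; [apply: TruncHigh; exact: ltW|lra].
Qed.

Lemma trunc_lipschitz (R : realType) (T x y : R) : 0 <= T ->
  `|trunc T x - trunc T y| <= `|x - y|.
Proof.
move=> T0; wlog xy : x y / x <= y.
  move=> W; have [xy|/ltW yx] := leP x y; first exact: W.
  by rewrite distrC (distrC x); exact: W.
rewrite distrC (distrC x) (ger0_norm (_ : 0 <= y - x)) ?subr_ge0//.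
rewrite ler_norml.
by case: (truncP x T0) => ?; case: (truncP y T0) => *; apply/andP; split; lra.
Qed.

Lemma truncN (R : realType) (T x : R) : 0 <= T -> trunc T (- x) = - trunc T x.
Proof.
by move=> T0; case: (truncP x T0); case: (truncP (- x) T0) => *; lra.
Qed.

Lemma trunc_gt0 (R : realType) (T x : R) : 0 < T -> (0 < trunc T x) = (0 < x).
Proof.
move=> T0; have NT : - T < 0 by lra.
by rewrite /trunc lt_max lt_min T0 andbT ltNge (ltW NT).
Qed.

Section TruncatedCost.
Context {R : realType} (phi : R -> R).
Context (phi_ge0 : forall x, 0 <= phi x) (phi_cvx : convexR phi)
  (phi0 : phi 0 = 1) (dphi : derivable phi 0 1) (c0 : 0 < derive1 phi 0).
Context (T : R) (T0 : 0 < T).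

Local Notation Phi := (fun x => phi (trunc T x)).

Lemma truncated_cost_lipschitz x y :
  `|Phi x - Phi y| <= (phi (T + 1) + phi (- T - 1)) * `|x - y|.
Proof.
apply: (le_trans (convex_lipschitz phi_ge0 phi_cvx _ _)).
- exact/trunc_in/ltW.
- exact/trunc_in/ltW.
- by rewrite ler_wpM2l ?addr_ge0// trunc_lipschitz// ltW.
Qed.

(** The chord over [[- T, T]] is a convex combination of two nonnegative values, hence at most their
    sum. *)
Lemma truncated_cost_le x : Phi x <= phi T + phi (- T).
Proof.
have /andP[Tx xT] := trunc_in x (ltW T0); set y := trunc T x in Tx xT *.
have := @phi_cvx T (- T) ((y + T) / (T + T)).
have TT : 0 < T + T by exact: addr_gt0.
rewrite (_ : _ * T + _ = y); last by field; rewrite gt_eqF.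
have /andP[t0 t1] : 0 <= (y + T) / (T + T) <= 1.
  by apply/andP; split; [apply: divr_ge0; lra|rewrite ler_pdivrMr//; lra].
rewrite t0 t1 => /(_ isT) /le_trans; apply.
by apply: lerD; rewrite ler_piMl//; lra.
Qed.

Lemma truncated_cost_le_cost e x : 0 <= e ->
  (forall t, T <= t -> phi (- T) <= phi (- t) + e) -> Phi x <= phi x + e.
Proof.
move=> e0 tail /=; case: (truncP x (ltW T0)) => [xT|xT|_ _].
- by have := tail (- x); rewrite opprK; apply; lra.
- by apply: ler_wpDr => //; apply: cost_nondecreasing => //; exact: ltW.
- by rewrite lerDl.
Qed.

Lemma measurable_truncated_cost : measurable_fun setT Phi.
Proof.
apply: continuous_measurable_fun => x.
set L := phi (T + 1) + phi (- T - 1).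
have L0 : 0 <= L by rewrite addr_ge0.
apply/cvgrPdist_lt => e e0; near=> y.
apply: (le_lt_trans (truncated_cost_lipschitz x y)).
rewrite -/L (@le_lt_trans _ _ ((L + 1) * `|x - y|))//.
  by rewrite ler_wpM2r// lerDl.
rewrite mulrC -ltr_pdivlMr ?ltr_wpDl//.
near: y; have := @nbhsx_ballx _ _ x (e / (L + 1)); apply.
by rewrite divr_gt0// ltr_wpDl.
Unshelve. all: by end_near. Qed.

End TruncatedCost.

(** [right_derivative] is a [lim], so convergence has to be proved first. By convexity the
    difference quotients at [x] are nondecreasing in [h], and they are bounded below by the slope at
    0, so they converge to their infimum. *)
Lemma right_derivative_ge (R : realType) (phi : R -> R) x :
  convexR phi -> phi 0 = 1 -> derivable phi 0 1 -> 0 <= x ->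
  derive1 phi 0 <= right_derivative phi x.
Proof.
move=> cphi phi0 dphi x0.
set c := derive1 phi 0.
pose q h := h^-1 * (phi (x + h) - phi x).
have tangent := convex_tangent cphi phi0 dphi.
(* The slope on [[x, x + h]] is at least the slope on [[0, x + h]], which the tangent at 0 bounds
   from below. *)
have qc h : 0 < h -> c <= q h.
  move=> h0; have xh : 0 < x + h by rewrite ltr_wpDl.
  have := @cphi (x + h) 0 (x / (x + h)).
  have t01 : 0 <= x / (x + h) <= 1.
    by apply/andP; split; [apply: divr_ge0; lra|rewrite ler_pdivrMr//; lra].
  rewrite mulr0 addr0 divfK ?gt_eqF// phi0 => /(_ t01).
  have E : x / (x + h) * (x + h) = x by rewrite divfK// gt_eqF.
  move=> /(ler_wpM2r (ltW xh)).
  set t := x / (x + h) in E *.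
  rewrite (_ : (_ + (1 - t) * 1) * _ =
    t * (x + h) * phi (x + h) + (x + h) - t * (x + h)); last by ring.
  rewrite E => C; have := tangent (x + h); rewrite -/c => C'.
  rewrite /q mulrC ler_pdivlMr//.
  have : h * (1 + c * (x + h)) <= h * phi (x + h) by rewrite ler_wpM2l// ltW.
  by move=> ?; rewrite -(ler_pM2r xh); lra.
have qnd h h' : 0 < h -> h <= h' -> q h <= q h'.
  move=> h0 hh'; have h'0 : 0 < h' := lt_le_trans h0 hh'.
  have := @cphi (x + h') x (h / h').
  rewrite (_ : _ * (x + h') + _ = x + h); last by field; rewrite gt_eqF.
  have t01 : 0 <= h / h' <= 1.
    by apply/andP; split; [apply: divr_ge0; lra|rewrite ler_pdivrMr//; lra].
  move=> /(_ t01) C; rewrite /q mulrC ler_pdivrMr//.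
  rewrite (_ : _ * _ * h = (h / h') * (phi (x + h') - phi x)); last by ring.
  by lra.
have cq : q h @[h --> 0^'+] --> inf (q @` [set` `]0, 1[]).
  apply: (@nondecreasing_at_right_cvgr _ q 0 (BLeft 1)).
  - by rewrite bnd_simp.
  - by move=> h h'; rewrite !in_itv/= => /andP[h0 _] _ hh'; exact: qnd.
  - by exists c => y [h /=]; rewrite in_itv/= => /andP[h0 _] <-; exact: qc.
rewrite /right_derivative; apply: limr_ge.
  by apply/cvg_ex; eexists; exact: cq.
by near=> h; apply: qc; near: h; exact: nbhs_right_gt.
Unshelve. all: by end_near. Qed.

(** * The Sauer-Shelah lemma *)

Section SauerShelah.
Context {T : finType}.
Implicit Types (F : {set {set T}}) (S A B : {set T}).

Definition fshatters F S :=
  [forall B : {set T}, (B \subset S) ==> [exists A in F, S :&: A == B]].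

Lemma fshattersP F S : reflect
  (forall B, B \subset S -> exists2 A, A \in F & S :&: A = B) (fshatters F S).
Proof.
apply: (iffP forallP) => [H B BS|H B].
  have /implyP/(_ BS)/existsP[A /andP[AF /eqP E]] := H B.
  by exists A.
apply/implyP => BS; have [A AF E] := H B BS.
by apply/existsP; exists A; rewrite AF E eqxx.
Qed.

Lemma fshattersS F F' S : F \subset F' -> fshatters F S -> fshatters F' S.
Proof.
move=> /fintype.subsetP FF' /fshattersP sh; apply/fshattersP => B /sh[A AF E].
by exists A => //; exact: FF'.
Qed.

(** On a set through [x], the empty trace is missing if all members contain [x], and the full trace
    is missing if none does. *)
Lemma fshatters_const x (b : bool) F S :
  (forall A, A \in F -> (x \in A) = b) -> fshatters F S -> x \notin S.
Proof.
move=> Fx /fshattersP sh; apply/negP => xS; case: b Fx => Fx.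
  have [A AF E] := sh finset.set0 (finset.sub0set _).
  have : x \in S :&: A by rewrite finset.inE xS (Fx A AF).
  by rewrite E finset.inE.
have [A AF E] := sh S (fintype.subxx _).
have : x \in S :&: A by rewrite E.
by rewrite finset.inE (Fx A AF) andbF.
Qed.

(* Pajor's form of the lemma: split F at a point x which some but not all of
   its members contain; a set shattered by both halves can be enlarged by x. *)
Lemma pajor F : (#|F| <= #|finset (fshatters F)|)%N.
Proof.
have [n] := ubnP #|F|; elim: n F => // n IH F; rewrite ltnS => Fn.
have [F1|F1] := leqP #|F| 1.
  have [->|[A AF]] := finset.set_0Vmem F; first by rewrite finset.cards0.
  apply: (leq_trans F1); apply/card_gt0P; exists finset.set0.
  rewrite finset.inE; apply/fshattersP => B; rewrite finset.subset0 => /eqP ->.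
  by exists A => //; rewrite finset.set0I.
have [A [B [AF BF AB]]] : exists A, exists B, [/\ A \in F, B \in F & A != B].
  have [A [B [? ? ?]]] := card_gt1P F1; by exists A, B.
have [x xAB] : exists x, (x \in A) != (x \in B).
  apply/existsP; apply: contraNT AB => /existsPn H.
  by apply/eqP/finset.setP => x; have := H x; rewrite negbK => /eqP.
pose F1' := finset (fun A => (A \in F) && (x \in A)).
pose F0' := finset (fun A => (A \in F) && (x \notin A)).
have FU : F = F1' :|: F0'.
  by apply/finset.setP => C; rewrite !finset.inE -andb_orr orbN andbT.
have FI : F1' :&: F0' = finset.set0.
  by apply/finset.setP => C; rewrite !finset.inE; case: (x \in C); rewrite ?andbF.
have FE : #|F| = (#|F1'| + #|F0'|)%N.
  by rewrite {1}FU finset.cardsU FI finset.cards0 subn0.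
have [F1gt F0gt] : (0 < #|F1'|)%N /\ (0 < #|F0'|)%N.
  case xA : (x \in A) xAB; case xB : (x \in B) => // _; split; apply/card_gt0P.
  - by exists A; rewrite finset.inE AF xA.
  - by exists B; rewrite finset.inE BF xB.
  - by exists B; rewrite finset.inE BF xB.
  - by exists A; rewrite finset.inE AF xA.
have lt1 : (#|F1'| < n)%N by apply: leq_trans Fn; rewrite FE -addn1 leq_add2l.
have lt0 : (#|F0'| < n)%N by apply: leq_trans Fn; rewrite FE -add1n leq_add2r.
set S1 := finset (fshatters F1'); set S0 := finset (fshatters F0').
have no1 S : S \in S1 -> x \notin S.
  rewrite finset.inE; apply: (@fshatters_const x true) => C.
  by rewrite finset.inE => /andP[_ ->].
have no0 S : S \in S0 -> x \notin S.
  rewrite finset.inE; apply: (@fshatters_const x false) => C.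
  by rewrite finset.inE => /andP[_ /negbTE ->].
pose SI := [set x |: S | S in S1 :&: S0]%SET.
have sub : (S1 :|: S0) :|: SI \subset finset (fshatters F).
  apply/fintype.subsetP => S; rewrite !finset.inE => /orP[/orP[]|].
  - by apply: fshattersS; rewrite FU; exact: finset.subsetUl.
  - by apply: fshattersS; rewrite FU; exact: finset.subsetUr.
  case/imsetP => S' S'in ->; move: (S'in).
  rewrite finset.inE => /andP[S'1 S'0].
  have xS' := no1 _ S'1.
  move: S'1 S'0; rewrite !finset.inE => /fshattersP sh1 /fshattersP sh0.
  apply/fshattersP => C Csub.
  have C'sub : C :\ x \subset S' by rewrite finset.subDset.
  case xC : (x \in C).
    have [D] := sh1 _ C'sub; rewrite finset.inE => /andP[DF xD] E.
    exists D => //.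
    by rewrite finset.setIUl (finset.setIidPl _) ?finset.sub1set// E finset.setD1K.
  have [D] := sh0 _ C'sub; rewrite finset.inE => /andP[DF xD] E.
  exists D => //; rewrite finset.setIUl E.
  have -> : [set x]%SET :&: D = finset.set0.
    apply/finset.setP => y; rewrite !finset.inE; case: eqP => //= ->.
    exact: negbTE.
  rewrite finset.set0U; apply/finset.setP => y; rewrite !finset.inE.
  by case: eqP => //= ->; rewrite xC.
have cSI : #|SI| = #|S1 :&: S0|.
  apply: card_in_imset => S S' SS1 SS1' E.
  have xS : x \notin S by apply: no1; move: SS1; rewrite finset.inE => /andP[].
  have xS' : x \notin S' by apply: no1; move: SS1'; rewrite finset.inE => /andP[].
  by rewrite -(finset.setU1K xS) E finset.setU1K.
apply: leq_trans (subset_leq_card sub).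
have disj : (S1 :|: S0) :&: SI = finset.set0.
  apply/finset.setP => S; rewrite finset.inE finset.in_set0; apply/negP => /andP[].
  move=> SU /imsetP[S' _ E]; have xS : x \in S by rewrite E !finset.inE eqxx.
  by move: SU; rewrite finset.inE => /orP[/no1|/no0]; rewrite xS.
(* As [SI] has as many members as the intersection of [S1] and [S0], the union has [#|S1| + #|S0|]
   members; the induction hypothesis applies to each half. *)
rewrite finset.cardsU disj finset.cards0 subn0 cSI finset.cardsUI FE.
by apply: leq_add; exact: IH.
Qed.

(** A set of at most [V] elements is the range of a map from ['I_V] to [option T], with [None] as
    padding. This crude count stands in for the sum of binomial coefficients. *)
Lemma card_small_sets V : (#|finset (fun S => #|S| <= V)%N| <= (#|T| + 1) ^ V)%N.
Proof.
pose g (f : {ffun 'I_V -> option T}) := finset (fun x => [exists i, f i == Some x]).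
have -> : ((#|T| + 1) ^ V = #|{ffun 'I_V -> option T}|)%N.
  by rewrite card_ffun card_option card_ord addn1.
apply: leq_trans (leq_imset_card g _).
apply: subset_leq_card; apply/fintype.subsetP => S; rewrite finset.inE => SV.
apply/imsetP; exists [ffun i : 'I_V => nth None (map Some (enum S)) i] => //.
apply/finset.setP => x; rewrite finset.inE; apply/idP/existsP => [xS|[i]].
  have xi : (index x (enum S) < V)%N.
    by apply: leq_trans SV; rewrite cardE index_mem mem_enum.
  exists (Ordinal xi); rewrite ffunE /= (nth_map x) ?index_mem ?mem_enum//.
  by rewrite nth_index// mem_enum.
rewrite ffunE; have [iS|iS] := ltnP i (size (enum S)).
  rewrite (nth_map x)// => /eqP[<-].
  by rewrite -(mem_enum S) mem_nth.
by rewrite nth_default// size_map.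
Qed.

Lemma sauer_shelah F V :
  (forall S, fshatters F S -> #|S| <= V)%N -> (#|F| <= (#|T| + 1) ^ V)%N.
Proof.
move=> H; apply: (leq_trans (pajor F)); apply: leq_trans (card_small_sets V).
by apply: subset_leq_card; apply/fintype.subsetP => S; rewrite !finset.inE => /H.
Qed.

End SauerShelah.

(** * Concentration on the discrete cube *)

Section CubeAverage.
Context {R : realType}.
Implicit Types (s : nat -> bool) (F G : (nat -> bool) -> R).

Definition flip_to s i b : nat -> bool := fun j => if j == i then b else s j.

Definition coord_average i F s :=
  (F (flip_to s i true) + F (flip_to s i false)) / 2.

(** Infinite bit sequences avoid types depending on [n]: coordinates from [n] on are read off the
    argument. The successive averages form the martingale of conditional means, from [F] to its mean
    over the cube. *)
Fixpoint cube_average n F : (nat -> bool) -> R :=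
  if n is m.+1 then coord_average m (cube_average m F) else F.

Lemma cube_average_le n F G s :
  (forall s, F s <= G s) -> cube_average n F s <= cube_average n G s.
Proof.
move=> FG; elim: n s => [|n IH] s //=; rewrite /coord_average.
by rewrite ler_pM2r// lerD.
Qed.

Lemma cube_average_sum (I : finType) (P : pred I) (F : I -> (nat -> bool) -> R) n s :
  cube_average n (fun s => \sum_(i | P i) F i s) s =
  \sum_(i | P i) cube_average n (F i) s.
Proof.
elim: n s => [|n IH] s //=; rewrite /coord_average !IH -big_split/= mulr_suml.
by apply: eq_bigr.
Qed.

Lemma cube_averageZ c F n s :
  cube_average n (fun s => c * F s) s = c * cube_average n F s.
Proof.
by elim: n s => [|n IH] s //=; rewrite /coord_average !IH -mulrDr mulrA.
Qed.

Lemma cube_average_cst c n s : cube_average n (fun=> c) s = c.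
Proof. by elim: n s => [|n IH] s //=; rewrite /coord_average !IH; field. Qed.

(** Flips at distinct coordinates commute, so averaging over the coordinates below [n] preserves a
    bound on differences in coordinate [i]. *)
Lemma cube_average_bounded_difference c i n F : (n <= i)%N ->
  (forall s, `|F (flip_to s i true) - F (flip_to s i false)| <= c) ->
  forall s, `|cube_average n F (flip_to s i true) -
              cube_average n F (flip_to s i false)| <= c.
Proof.
move=> + Fi; elim: n => [|n IH] //= ni s.
have b t : forall b b', flip_to (flip_to t i b) n b' = flip_to (flip_to t n b') i b.
  move=> b b'; apply/funext => j; rewrite /flip_to.
  case: (eqVneq j n) => [->|//]; case: eqVneq => // E.
  by move: ni; rewrite E ltnn.
rewrite /coord_average !b -mulrBl normrM (ger0_norm (_ : 0 <= 2^-1 :> R))//.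
rewrite ler_pdivrMr// opprD addrACA (le_trans (ler_normD _ _))//.
by rewrite mulr_natr mulr2n lerD// IH// ltnW.
Qed.

(** With [x = (a - b) / 2] this says [cosh x <= exp (2 x^2)], weaker than the sharp [exp (x^2 / 2)]
    but elementary: if [x^2 <= 1/2], through [cosh x <= 1 / (1 - x^2) <= 1 + 2 x^2]; otherwise
    because [|x| <= 2 x^2]. *)
Lemma exp_two_points (a b : R) :
  (expR a + expR b) / 2 <= expR ((a + b) / 2 + (a - b) ^+ 2 / 2).
Proof.
pose x := (a - b) / 2; pose m := (a + b) / 2.
have -> : a = m + x by rewrite /m /x; field.
have -> : b = m - x by rewrite /m /x; field.
have -> : (m + x + (m - x)) / 2 + (m + x - (m - x)) ^+ 2 / 2 = m + 2 * x ^+ 2.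
  by field.
rewrite !expRD -mulrDr -mulrA ler_pM2l ?expR_gt0//.
have ge1 (y : R) := expR_ge1Dx y.
have [x2|x2] := leP (x ^+ 2) (1 / 2); last first.
  have x1 : `|x| <= 2 * x ^+ 2.
    rewrite -(real_normK (num_real x)); rewrite -(real_normK (num_real x)) in x2.
    have := normr_ge0 x; nra.
  have e1 : expR x <= expR (2 * x ^+ 2).
    by rewrite ler_expR (le_trans (ler_norm x)).
  have e2 : expR (- x) <= expR (2 * x ^+ 2).
    by rewrite ler_expR (le_trans (ler_norm _))// normrN.
  by lra.
have x10 : 0 < 1 - x by nra.
have x01 : 0 < 1 + x by nra.
have e1 : expR x <= (1 - x)^-1.
  have -> : expR x = (expR (- x))^-1 by rewrite -expRN opprK.
  by rewrite lef_pV2 ?posrE ?expR_gt0//; exact: ge1.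
have e2 : expR (- x) <= (1 + x)^-1.
  by rewrite expRN lef_pV2 ?posrE ?expR_gt0.
have e3 := ge1 (2 * x ^+ 2).
apply: (@le_trans _ _ ((1 - x ^+ 2)^-1)).
  rewrite (_ : (1 - x ^+ 2)^-1 = ((1 - x)^-1 + (1 + x)^-1) / 2).
    by rewrite ler_pM2r// lerD.
  by field; rewrite !gt_eqF//; nra.
have x20 : 0 < 1 - x ^+ 2 by lra.
rewrite -(ler_pM2r x20) mulVf ?gt_eqF//.
have : 0 <= x ^+ 2 by exact: sqr_ge0.
nra.
Qed.

(** McDiarmid's argument: averaging over one more coordinate costs a factor [exp (c^2 / 2)], by the
    two-point inequality for the partial average, which inherits the bounded differences of [F]. *)
Lemma bounded_differences_mgf (c : R) n F : 0 <= c ->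
  (forall i s, (i < n)%N -> `|F (flip_to s i true) - F (flip_to s i false)| <= c) ->
  forall s, cube_average n (fun s => expR (F s)) s <=
            expR (cube_average n F s + n%:R * c ^+ 2 / 2).
Proof.
move=> c0; elim: n => [|n IH] Fc s /=; first by rewrite mul0r mul0r addr0.
rewrite {1}/coord_average.
have {}IH := IH (fun i s h => Fc i s (ltnW h)).
set G := cube_average n F.
have Gn : `|G (flip_to s n true) - G (flip_to s n false)| <= c.
  by apply: cube_average_bounded_difference => // s'; exact: Fc.
have le1 : (cube_average n (fun s => expR (F s)) (flip_to s n true) +
   cube_average n (fun s => expR (F s)) (flip_to s n false)) / 2 <=
   (expR (G (flip_to s n true)) + expR (G (flip_to s n false))) / 2 *
     expR (n%:R * c ^+ 2 / 2).
  rewrite mulrAC ler_pM2r// mulrDl -!expRD.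
  by rewrite lerD// IH.
apply: (le_trans le1).
apply: (le_trans (ler_wpM2r (expR_ge0 _) (exp_two_points _ _))).
rewrite -expRD ler_expR /coord_average -addrA lerD2l -[n.+1%:R]natr1.
have : (G (flip_to s n true) - G (flip_to s n false)) ^+ 2 <= c ^+ 2.
  by rewrite -(real_normK (num_real _)) ler_sqr ?nnegrE.
lra.
Qed.

Lemma cube_average_locality n k F : (k <= n)%N ->
  (forall s s', (forall i, (i < n)%N -> s i = s' i) -> F s = F s') ->
  forall s s', (forall i, (k <= i < n)%N -> s i = s' i) ->
  cube_average k F s = cube_average k F s'.
Proof.
move=> + FE; elim: k => [|k IH] kn s s' ss' /=; first exact: FE.
have E b : cube_average k F (flip_to s k b) = cube_average k F (flip_to s' k b).
  apply: IH; first exact: ltnW.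
  move=> i /andP[ki iN]; rewrite /flip_to; case: eqVneq => // ik.
  by apply: ss'; rewrite iN ltn_neqAle ki eq_sym ik.
by rewrite /coord_average !E.
Qed.

(** Complementing all bits permutes the cube, so the mean equals its own opposite; by locality it
    does not depend on the starting sequence. *)
Lemma cube_average_odd n F :
  (forall s s', (forall i, (i < n)%N -> s i = s' i) -> F s = F s') ->
  (forall s, F (fun i => ~~ s i) = - F s) ->
  forall s, cube_average n F s = 0.
Proof.
move=> FE Fodd s.
have odd k t : cube_average k F (fun i => ~~ t i) = - cube_average k F t.
  elim: k t => [|k IH] t //=; rewrite /coord_average.
  have E b : flip_to (fun i => ~~ t i) k b = (fun i => ~~ flip_to t k (~~ b) i).
    by apply/funext => i; rewrite /flip_to; case: eqP => // _; rewrite negbK.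
  by rewrite !E !IH -mulNr opprD addrC.
have := odd n s.
rewrite (@cube_average_locality n n F (leqnn _) FE _ s); last first.
  by move=> i /andP[ni /(leq_ltn_trans ni)]; rewrite ltnn.
by move=> /eqP; rewrite -addr_eq0 -mulr2n mulrn_eq0 => /eqP.
Qed.

End CubeAverage.

(** * U-statistics under exchanges of two samples *)

Section SwapDeviation.
Context {R : realType} (n : nat).
Local Notation sample := ('I_n * bool)%type.
Implicit Types (u v : sample * sample -> R) (s : nat -> bool).

(* Difference of two U-statistics with kernel u when s decides, for each i,
   which of the points (i, true), (i, false) belongs to the second sample. *)
Definition swap_deviation u s : R :=
  (n%:R * (n%:R - 1))^-1 *
  \sum_(i < n) \sum_(j < n | j != i)
    (u ((i, ~~ s i), (j, ~~ s j)) - u ((i, s i), (j, s j))).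

Lemma ustat_weight_ge0 : 0 <= (n%:R * (n%:R - 1))^-1 :> R.
Proof.
case: n => [|m]; first by rewrite mul0r invr0.
by rewrite invr_ge0 mulr_ge0// subr_ge0 ler1n.
Qed.

Let ustat_weight_neq0 :
  (2 <= n)%N -> n%:R - 1 != 0 :> R /\ n%:R != 0 :> R.
Proof.
by case: n => [|[|m]]// _; rewrite subr_eq0 pnatr_eq0 (eqr_nat _ _ 1).
Qed.

Lemma ustat_weight_sum (c : R) : (2 <= n)%N ->
  (n%:R * (n%:R - 1))^-1 * \sum_(i < n) \sum_(j < n | j != i) c = c.
Proof.
move=> n2.
under eq_bigr => i _ do rewrite sumr_const cardC1 card_ord.
rewrite sumr_const card_ord -(mulr_natr (_ *+ _) n) -(mulr_natr c) -subn1.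
rewrite natrB ?(ltnW n2)//.
by field; have [-> ->] := ustat_weight_neq0 n2.
Qed.

Lemma swap_deviation_le u v e s : (2 <= n)%N ->
  (forall p, `|u p - v p| <= e) ->
  swap_deviation u s <= swap_deviation v s + 2 * e.
Proof.
move=> n2 uv; rewrite -[X in _ + X](ustat_weight_sum _ n2) -mulrDr.
apply: ler_wpM2l; first exact: ustat_weight_ge0.
rewrite -big_split/=; apply: ler_sum => i _.
rewrite -big_split/=; apply: ler_sum => j _.
have := uv ((i, ~~ s i), (j, ~~ s j)); have := uv ((i, s i), (j, s j)).
rewrite !ler_norml => /andP[? ?] /andP[? ?]; lra.
Qed.

(** Bit [k] affects the [2 (n - 1)] ordered pairs that contain [k], each by at most [2 M]; the
    weight [1 / (n (n - 1))] leaves [4 M / n]. *)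
Lemma swap_deviation_bounded_difference u M k s : (2 <= n)%N -> (k < n)%N ->
  (forall p, 0 <= u p <= M) ->
  `|swap_deviation u (flip_to s k true) - swap_deviation u (flip_to s k false)|
    <= 4 * M / n%:R.
Proof.
move=> n2 kn uM; pose K := Ordinal kn.
rewrite /swap_deviation -mulrBr normrM (ger0_norm ustat_weight_ge0).
rewrite -sumrB.
have term (i j : 'I_n) : `|(u ((i, ~~ flip_to s k true i), (j, ~~ flip_to s k true j)) -
   u ((i, flip_to s k true i), (j, flip_to s k true j))) -
   (u ((i, ~~ flip_to s k false i), (j, ~~ flip_to s k false j)) -
   u ((i, flip_to s k false i), (j, flip_to s k false j)))| <=
   2 * M * (i == K)%:R + 2 * M * (j == K)%:R.
  have M0 : 0 <= M by have /andP[] := uM ((i, true), (i, true)); exact: le_trans.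
  have [iK|iK] := eqVneq i K; last have [jK|jK] := eqVneq j K; last first.
    have Hf b (l : 'I_n) : l != K -> flip_to s k b l = s l.
      by rewrite /flip_to -(inj_eq val_inj) => /negbTE /= ->.
    by rewrite !Hf// subrr normr0 !mulr0 addr0.
  all: rewrite ?mulr1 ?mulr0 ?add0r ?addr0.
    have /andP[? ?] := uM ((i, ~~ flip_to s k true i), (j, ~~ flip_to s k true j)).
    have /andP[? ?] := uM ((i, flip_to s k true i), (j, flip_to s k true j)).
    have /andP[? ?] := uM ((i, ~~ flip_to s k false i), (j, ~~ flip_to s k false j)).
    have /andP[? ?] := uM ((i, flip_to s k false i), (j, flip_to s k false j)).
    by rewrite ler_norml; apply/andP; split; lra.
  have /andP[? ?] := uM ((i, ~~ flip_to s k true i), (j, ~~ flip_to s k true j)).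
  have /andP[? ?] := uM ((i, flip_to s k true i), (j, flip_to s k true j)).
  have /andP[? ?] := uM ((i, ~~ flip_to s k false i), (j, ~~ flip_to s k false j)).
  have /andP[? ?] := uM ((i, flip_to s k false i), (j, flip_to s k false j)).
  have ? : 0 <= 2 * M * (j == K)%:R by rewrite !mulr_ge0.
  by rewrite ler_norml; apply/andP; split; lra.
apply: (@le_trans _ _ ((n%:R * (n%:R - 1))^-1 *
    \sum_(i < n) \sum_(j < n | j != i) (2 * M * (i == K)%:R + 2 * M * (j == K)%:R))).
  apply: ler_wpM2l; first exact: ustat_weight_ge0.
  apply: (le_trans (ler_norm_sum _ _ _)); apply: ler_sum => i _.
  rewrite -sumrB; apply: (le_trans (ler_norm_sum _ _ _)); exact: ler_sum.
have S1 : \sum_(i < n) \sum_(j < n | j != i) (2 * M * (i == K)%:R) =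
    2 * M * (n%:R - 1) :> R.
  rewrite (bigD1 K)//= eqxx mulr1 [X in _ + X]big1 ?addr0; last first.
    by move=> i /negbTE ->; rewrite mulr0 big1.
  by rewrite sumr_const cardC1 card_ord -(mulr_natr (2 * M)) -subn1 natrB ?(ltnW n2).
have S2 : \sum_(i < n) \sum_(j < n | j != i) (2 * M * (j == K)%:R) =
    2 * M * (n%:R - 1) :> R.
  rewrite -S1 (exchange_big_dep predT)//=; apply: eq_bigr => j _.
  by apply: eq_bigl => i; rewrite eq_sym.
under eq_bigr => i _ do rewrite big_split/=.
rewrite big_split/= S1 S2 le_eqVlt; apply/orP; left; apply/eqP.
by field; have [-> ->] := ustat_weight_neq0 n2.
Qed.

(** The deviation changes sign when all bits are flipped, so its mean is zero. What remains is
    [n c^2 / 2] with [c = |l| 4 M / n]. *)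
Lemma swap_deviation_mgf u M l s : (2 <= n)%N -> 0 <= M ->
  (forall p, 0 <= u p <= M) ->
  cube_average n (fun s => expR (l * swap_deviation u s)) s <=
  expR (8 * M ^+ 2 * l ^+ 2 / n%:R).
Proof.
move=> n2 M0 uM.
have n0 : 0 < n%:R :> R by rewrite ltr0n ltnW.
apply: (le_trans (@bounded_differences_mgf _ (`|l| * (4 * M / n%:R)) _ _ _ _ _)).
- by rewrite mulr_ge0// divr_ge0// mulr_ge0.
- move=> k t kn; rewrite -mulrBr normrM ler_wpM2l//.
  exact: swap_deviation_bounded_difference.
rewrite cube_average_odd ?add0r; last 2 first.
- move=> t t' tt'; congr (_ * (_ * _)); apply: eq_bigr => i _.
  by apply: eq_bigr => j _; rewrite !tt'.
- move=> t; rewrite /swap_deviation -!mulrN; congr (_ * (_ * _)).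
  rewrite -sumrN; apply: eq_bigr => i _; rewrite -sumrN; apply: eq_bigr => j _.
  by rewrite !negbK opprB.
rewrite ler_expR exprMn real_normK ?num_real// le_eqVlt; apply/orP; left; apply/eqP.
by field; rewrite gt_eqF.
Qed.

End SwapDeviation.

(** * Approximation of convex combinations by averages *)

Section IidMixture.
Context {R : realType} (I : finType) (p : I -> R).
Context (p_ge0 : forall j, 0 <= p j) (p_sum : \sum_j p j = 1).

(* Expectation of G (J_1, ..., J_k) for J_1, ..., J_k i.i.d. of law p. *)
Fixpoint iid_mean k (G : seq I -> R) : R :=
  if k is m.+1 then \sum_j p j * iid_mean m (fun s => G (j :: s)) else G [::].

Lemma iid_mean_le k G H : (forall s, size s = k -> G s <= H s) ->
  iid_mean k G <= iid_mean k H.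
Proof.
elim: k G H => [|k IH] G H GH /=; first exact: GH.
apply: ler_sum => j _; apply: ler_wpM2l => //; apply: IH => s sk.
by apply: GH; rewrite /= sk.
Qed.

Lemma iid_meanZ k c G : iid_mean k (fun s => c * G s) = c * iid_mean k G.
Proof.
elim: k G => [|k IH] G //=; rewrite mulr_sumr; apply: eq_bigr => j _.
by rewrite IH mulrCA.
Qed.

Lemma iid_meanD k G H :
  iid_mean k (fun s => G s + H s) = iid_mean k G + iid_mean k H.
Proof.
elim: k G H => [|k IH] G H //=; rewrite -big_split; apply: eq_bigr => j _ /=.
by rewrite IH mulrDr.
Qed.

Lemma iid_mean_sum (J : finType) (P : pred J) k (G : J -> seq I -> R) :
  iid_mean k (fun s => \sum_(i | P i) G i s) = \sum_(i | P i) iid_mean k (G i).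
Proof.
elim: k G => [|k IH] G //=.
under eq_bigr => j _ do rewrite IH mulr_sumr.
by rewrite exchange_big.
Qed.

Lemma iid_mean_cst k c : iid_mean k (fun=> c) = c.
Proof.
elim: k => [|k IH] //=; under eq_bigr => j _ do rewrite IH.
by rewrite -mulr_suml p_sum mul1r.
Qed.

(** First moment method: it turns Maurey's random draw into one fixed selection of rules. *)
Lemma iid_mean_witness k G : exists2 s, size s = k & iid_mean k G <= G s.
Proof.
apply: contrapT => /forall2NP H.
(* The mean is generalized to a bound [c] that can stay fixed in the induction, while the mean
   itself changes once the first draw is fixed. *)
have [c [lt]] : exists c, (forall s, size s = k -> G s < c) /\ c <= iid_mean k G.
  exists (iid_mean k G); split => // s sk.
  by have [//|/negP] := H s; rewrite -ltNge.
move: {H} lt.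
elim: k G c => [|k IH] G c /= lt ck.
  by have := lt [::] erefl; rewrite ltNge ck.
have [j /negP] : exists j, ~ (iid_mean k (fun s => G (j :: s)) < c).
  apply/existsNP => Hj.
  have := ck; rewrite leNgt => /negP; apply.
  rewrite -subr_gt0 -[X in X - _]mulr1 -p_sum mulr_sumr -sumrB.
  rewrite lt_neqAle eq_sym sumr_ge0 ?andbT; last first.
    by move=> j _; rewrite mulrC -mulrBr mulr_ge0// subr_ge0 ltW.
  rewrite psumr_eq0; last first.
    by move=> j _; rewrite mulrC -mulrBr mulr_ge0// subr_ge0 ltW.
  apply/negP => /allP p0.
  have : \sum_j p j = 0.
    rewrite big1// => j _; have := p0 j; rewrite mem_index_enum => /(_ isT)/=.
    by rewrite mulrC -mulrBr mulf_eq0 subr_eq0 (gt_eqF (Hj j)) orbF => /eqP.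
  by rewrite p_sum => /eqP; rewrite oner_eq0.
rewrite -leNgt => cj.
by apply: (IH (fun s => G (j :: s)) c _ cj) => s sk; apply: lt; rewrite /= sk.
Qed.

(** Squared mean plus variance, each term contributing at most [b ^ 2] to the latter. The shift [c]
    absorbs the terms already drawn. *)
Lemma iid_mean_square k (v : I -> R) b c : (forall j, `|v j| <= b) ->
  iid_mean k (fun s => (c + \sum_(j <- s) v j) ^+ 2) <=
  (c + k%:R * \sum_j p j * v j) ^+ 2 + k%:R * b ^+ 2.
Proof.
move=> vb; set m := \sum_j p j * v j.
elim: k c => [|k IH] c /=; first by rewrite big_nil !mul0r !addr0.
have step j : iid_mean k (fun s => (c + \sum_(i <- j :: s) v i) ^+ 2) =
    iid_mean k (fun s => (c + v j + \sum_(i <- s) v i) ^+ 2).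
  by congr iid_mean; apply/funext => s; rewrite big_cons addrA.
under eq_bigr => j _ do rewrite step.
apply: (@le_trans _ _ (\sum_j p j * ((c + v j + k%:R * m) ^+ 2 + k%:R * b ^+ 2))).
  by apply: ler_sum => j _; apply: ler_wpM2l.
have E : \sum_j p j * ((c + v j + k%:R * m) ^+ 2 + k%:R * b ^+ 2) =
   (c + k%:R * m) ^+ 2 + 2 * (c + k%:R * m) * m + \sum_j p j * v j ^+ 2
   + k%:R * b ^+ 2.
  transitivity (\sum_j ((c + k%:R * m) ^+ 2 * p j +
    2 * (c + k%:R * m) * (p j * v j) + p j * v j ^+ 2 + k%:R * b ^+ 2 * p j)).
    by apply: eq_bigr => j _; ring.
  by rewrite !big_split/= -!mulr_sumr p_sum !mulr1.
have V : \sum_j p j * v j ^+ 2 <= b ^+ 2.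
  rewrite -[b ^+ 2]mulr1 -[X in _ * X]p_sum mulr_sumr; apply: ler_sum => j _.
  rewrite mulrC; apply: ler_wpM2r => //; rewrite -(real_normK (num_real (v j))).
  by rewrite lerXn2r ?nnegrE// (le_trans _ (vb j)).
by rewrite E -[k.+1%:R]natr1; nra.
Qed.

End IidMixture.

(** Rules drawn with probability [|w j| / B], taken with the sign of [w j] and averaged with factor
    [B / k], have mean [f] and variance at most [B^2 / k]. Young's inequality bounds the Lipschitz
    error by [delta] plus a multiple of the squared error, so second moments suffice. The values
    [g j] belong to one point, but the law depends on the weights alone, so one draw serves all
    points at once. *)
Lemma maurey (R : realType) (Psi : R -> R) (L : R) N (w : 'I_N -> R) (B t : R)
    (g : 'I_N -> R) k (delta : R) :
  (forall x y, `|Psi x - Psi y| <= L * `|x - y|) ->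
  0 < B -> \sum_j `|w j| = B -> `|t| <= 1 -> (forall j, `|g j| <= 1) ->
  (0 < k)%N -> 0 < delta ->
  `|Psi (t * \sum_j w j * g j) -
    iid_mean (fun j => `|w j| / B) k (fun J =>
      Psi (t * (B / k%:R * \sum_(j <- J) (if 0 <= w j then g j else - g j))))|
  <= delta + L ^+ 2 * B ^+ 2 / (4 * delta * k%:R).
Proof.
move=> PsiL B0 wB t1 g1 k0 d0.
pose p j := `|w j| / B; pose v j := if 0 <= w j then g j else - g j.
have L0 : 0 <= L.
  by have := le_trans (normr_ge0 _) (PsiL 1 0); rewrite subr0 normr1 mulr1.
have p0 j : 0 <= p j by rewrite divr_ge0// ltW.
have p1 : \sum_j p j = 1 by rewrite -mulr_suml wB divff// gt_eqF.
have kp : 0 < k%:R :> R by rewrite ltr0n.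
set f := \sum_j w j * g j.
have mf : \sum_j p j * v j = f / B.
  rewrite mulr_suml; apply: eq_bigr => j _; rewrite /p /v.
  case: ifPn => w0; first by rewrite ger0_norm// mulrAC.
  by rewrite ler0_norm ?ltW ?ltNge// mulrN !mulNr opprK mulrAC.
pose S J := B / k%:R * \sum_(j <- J) v j.
rewrite -/(S _) -/p.
have pt J : `|Psi (t * f) - Psi (t * S J)| <=
    delta + L ^+ 2 / (4 * delta) * (S J - f) ^+ 2.
  apply: (le_trans (PsiL _ _)); rewrite -mulrBr normrM.
  apply: (@le_trans _ _ (L * `|S J - f|)).
    by rewrite ler_wpM2l// distrC ler_piMl.
  rewrite -(real_normK (num_real (S J - f))); set x := `|_|.
  rewrite -subr_ge0 (_ : _ - _ = (L * x - 2 * delta) ^+ 2 / (4 * delta)).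
    by rewrite divr_ge0 ?sqr_ge0// mulr_ge0// ltW.
  by field; rewrite gt_eqF.
have sq : iid_mean p k (fun J => delta + L ^+ 2 / (4 * delta) * (S J - f) ^+ 2)
    <= delta + L ^+ 2 * B ^+ 2 / (4 * delta * k%:R).
  rewrite iid_meanD iid_mean_cst// lerD2l iid_meanZ.
  have -> : L ^+ 2 * B ^+ 2 / (4 * delta * k%:R) =
     L ^+ 2 / (4 * delta) * (B ^+ 2 / k%:R) by field; rewrite !gt_eqF.
  apply: ler_wpM2l; first by rewrite divr_ge0 ?sqr_ge0// mulr_ge0// ltW.
  have -> : (fun J => (S J - f) ^+ 2) = (fun J => (B / k%:R) ^+ 2 *
      (- (k%:R * (f / B)) + \sum_(j <- J) v j) ^+ 2).
    by apply/funext => J; rewrite /S; field; rewrite !gt_eqF.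
  rewrite iid_meanZ.
  have v1 j : `|v j| <= 1 by rewrite /v; case: ifP; rewrite ?normrN.
  have := iid_mean_square p0 p1 k (- (k%:R * (f / B))) v1.
  rewrite mf addNr expr0n/= add0r expr1n mulr1 => le.
  apply: (le_trans (ler_wpM2l (sqr_ge0 _) le)).
  by rewrite le_eqVlt; apply/orP; left; apply/eqP; field; rewrite gt_eqF.
have E G : G - iid_mean p k (fun J => Psi (t * S J)) =
    iid_mean p k (fun J => G + (-1) * Psi (t * S J)).
  by rewrite iid_meanD iid_mean_cst// iid_meanZ mulN1r.
rewrite E ler_norml; apply/andP; split.
- rewrite lerNl -(mulN1r (iid_mean _ _ _)) -iid_meanZ.
  apply: le_trans sq; apply: iid_mean_le => // J _.
  rewrite mulrDr !mulN1r opprK addrC -opprB.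
  by apply: le_trans (pt J); rewrite -normrN ler_norm.
- apply: le_trans sq; apply: iid_mean_le => // J _.
  by rewrite mulN1r; exact: le_trans (ler_norm _) (pt J).
Qed.

(** * Losses of combinations, seen through finitely many sign patterns *)

Section PatternClass.
Context {R : realType} (n : nat) (Psi : R -> R) (L M : R).
Context (Psi_lip : forall x y, `|Psi x - Psi y| <= L * `|x - y|).
Context (Psi_bnd : forall x, 0 <= Psi x <= M).
Local Notation sample := ('I_n * bool)%type.
Context (t : sample * sample -> R) (t1 : forall i, `|t i| <= 1).
Context (Pat : {set {set sample * sample}}) (B : R) (B0 : 0 < B).

Definition pattern_kernel (u : sample * sample -> R) := exists N (w : 'I_N -> R)
    (g : 'I_N -> sample * sample -> R),
  [/\ \sum_j `|w j| = B, forall j i, g j i = 1 \/ g j i = -1,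
      forall j, finset (fun i => g j i == 1) \in Pat &
      forall i, u i = Psi (t i * \sum_j w j * g j i)].

(** A negative weight replaces a rule by its opposite, whose pattern is the complement; hence the
    factor 2 in the count. *)
Let Pat2 := Pat :|: [set ~: A | A in Pat]%SET.

Let combination k (A : {ffun 'I_k -> {set sample * sample}}) i :=
  Psi (t i * (B / k%:R * \sum_l (if i \in A l then 1 else -1))).

(** The deviation is linear in the kernel, so the deviation of Maurey's mean is a mean of
    deviations, and some draw reaches it. That draw may depend on [s]. *)
Lemma pattern_kernel_swap_deviation u s k delta : (2 <= n)%N -> (0 < k)%N ->
  0 < delta -> pattern_kernel u ->
  exists2 A, A \in ffun_on (mem Pat2) &
    swap_deviation u s <= swap_deviation (@combination k A) s +
      2 * (delta + L ^+ 2 * B ^+ 2 / (4 * delta * k%:R)).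
Proof.
move=> n2 k0 d0 [N [w [g [wB g1 gPat uE]]]].
pose p j := `|w j| / B.
have p0 j : 0 <= p j by rewrite divr_ge0// ltW.
have p1 : \sum_j p j = 1 by rewrite -mulr_suml wB divff// gt_eqF.
pose v j i := if 0 <= w j then g j i else - g j i.
pose S J i := Psi (t i * (B / k%:R * \sum_(j <- J) v j i)).
have approx i : `|u i - iid_mean p k (fun J => S J i)| <=
    delta + L ^+ 2 * B ^+ 2 / (4 * delta * k%:R).
  rewrite uE; apply: (maurey Psi_lip B0 wB (t1 i)) => // j.
  by have [->|->] := g1 j i; rewrite ?normrN normr1.
have meanE : swap_deviation (fun i => iid_mean p k (fun J => S J i)) s =
    iid_mean p k (fun J => swap_deviation (S J) s).
  rewrite iid_meanZ iid_mean_sum; congr (_ * _); apply: eq_bigr => i _.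
  rewrite iid_mean_sum; apply: eq_bigr => j _.
  rewrite -(mulN1r (iid_mean _ _ _)) -iid_meanZ -iid_meanD.
  by congr iid_mean; apply/funext => J; rewrite mulN1r.
have [J Jk Jle] := iid_mean_witness p0 p1 k (fun J => swap_deviation (S J) s).
pose a j := finset (fun i => v j i == 1).
have aPat j : a j \in Pat2.
  rewrite finset.inE; case: (leP 0 (w j)) => w0; apply/orP; [left|right].
    have -> // : a j = finset (fun i => g j i == 1).
    by apply/finset.setP => i; rewrite !finset.inE /v w0.
  apply/imsetP; exists (finset (fun i => g j i == 1)) => //.
  apply/finset.setP => i; rewrite !finset.inE /v leNgt w0/=.
  have ne : (-1 == 1 :> R) = false by rewrite lt_eqF// ltrN10.
  by have [->|->] := g1 j i; rewrite ?opprK ?eqxx ?ne.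
have Jt : size J == k by apply/eqP.
exists [ffun l => a (tnth (Tuple Jt) l)].
  by apply/ffun_onP => l; rewrite ffunE.
apply: (le_trans (swap_deviation_le s n2 approx)); rewrite lerD2r meanE.
apply: (le_trans Jle); rewrite le_eqVlt; apply/orP; left; apply/eqP.
congr swap_deviation; apply/funext => i; rewrite /S /combination.
congr (Psi (_ * (_ * _))).
rewrite -[J]/(tval (Tuple Jt)) big_tuple; apply: eq_bigr => l _.
rewrite ffunE finset.inE /v; set j := tnth _ _.
have ne : (-1 == 1 :> R) = false by rewrite lt_eqF// ltrN10.
by case: ifP => _; have [->|->] := g1 j i; rewrite ?opprK ?eqxx ?ne.
Qed.

(** Since the kernel changes with [s], the concentration bound does not apply to it directly. Its
    exponential is first dominated by a sum over all [k]-tuples of patterns, where each term has a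
    kernel independent of [s]. *)
Lemma pattern_class_mgf (H : (nat -> bool) -> sample * sample -> R) l k delta s :
  (2 <= n)%N -> (0 < k)%N -> 0 < delta -> 0 <= l ->
  (forall s, pattern_kernel (H s)) ->
  cube_average n (fun s => expR (l * swap_deviation (H s) s)) s <=
  expR (2 * l * (delta + L ^+ 2 * B ^+ 2 / (4 * delta * k%:R))) *
  (2 * #|Pat|%:R) ^+ k * expR (8 * M ^+ 2 * l ^+ 2 / n%:R).
Proof.
move=> n2 k0 d0 l0 HP.
set err := delta + _.
have M0 : 0 <= M by have /andP[] := Psi_bnd 0; exact: le_trans.
apply: (@le_trans _ _ (cube_average n (fun s => expR (2 * l * err) *
    \sum_(A in ffun_on (mem Pat2)) expR (l * swap_deviation (@combination k A) s)) s)).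
  apply: cube_average_le => {}s.
  have [A AF Ale] := pattern_kernel_swap_deviation s n2 k0 d0 (HP s).
  apply: (@le_trans _ _ (expR (2 * l * err) *
      expR (l * swap_deviation (@combination k A) s))).
    rewrite -expRD ler_expR (mulrC 2) -mulrA -mulrDr addrC.
    exact: ler_wpM2l.
  apply: ler_wpM2l; first exact: expR_ge0.
  rewrite (bigD1 A)//= lerDl sumr_ge0// => *; exact: expR_ge0.
rewrite cube_averageZ cube_average_sum -[X in _ <= X]mulrA.
apply: ler_wpM2l; first exact: expR_ge0.
apply: (@le_trans _ _ (\sum_(A in ffun_on (mem Pat2)) expR (8 * M ^+ 2 * l ^+ 2 / n%:R))).
  by apply: ler_sum => A _; apply: swap_deviation_mgf => // i; exact: Psi_bnd.
rewrite sumr_const -(mulr_natl (expR _)) ler_wpM2r ?expR_ge0//.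
rewrite card_ffun_on card_ord natrX lerXn2r ?nnegrE ?mulr_ge0//.
rewrite -natrM ler_nat (leq_trans (leq_card_setU _ _))// mul2n -addnn leq_add2l.
exact: leq_imset_card.
Qed.

End PatternClass.

(** * Traces of a VC class on finitely many points *)

Lemma card_eq_fintype_set (I : finType) (S : {set I}) : ([set` S] #= `I_#|S|)%card.
Proof.
have -> : `I_#|S| = (fun i => index i (enum S)) @` [set` S].
  apply/seteqP; split=> [k /= kS|_ [i /= iS <-]]; last first.
    by rewrite cardE index_mem mem_enum.
  have [x0 _] : exists x0, x0 \in S by apply/card_gt0P; exact: leq_trans kS.
  exists (nth x0 (enum S) k); first by rewrite /= -mem_enum mem_nth// -cardE.
  by rewrite index_uniq ?enum_uniq// -cardE.
rewrite card_eq_sym; apply: inj_card_eq => i j; rewrite !inE /= => iS jS E.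
have := congr1 (nth i (enum S)) E.
by rewrite !nth_index ?mem_enum.
Qed.

(** Traces are recorded as sets of indices because the points [q i] need not be distinct. *)
Definition patterns (T : Type) (C : set (set T)) (I : finType) (q : I -> T) :
    {set {set I}} :=
  finset (fun A : {set I} =>
    `[< exists2 c, C c & forall i, (i \in A) = `[< c (q i) >] >]).

(** On a shattered set of indices [q] is injective, since equal points cannot be separated; its
    image is therefore a set of the same cardinality shattered by [C]. *)
Lemma card_patterns (T : Type) (C : set (set T)) V (I : finType) (q : I -> T) :
  has_VC_dimension C V -> (#|patterns C q| <= (#|I| + 1) ^ V)%N.
Proof.
move=> [_ VC]; apply: sauer_shelah => S /fshattersP sh.
have trace (B : {set I}) : B \subset S ->
    exists2 c, C c & forall i, i \in S -> (i \in B) = `[< c (q i) >].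
  move=> BS; have [A] := sh B BS; rewrite finset.inE => /asboolP[c Cc cA] E.
  by exists c => // i iS; rewrite -E finset.inE iS cA.
have qinj : {in [set` S] &, injective q}.
  move=> i j; rewrite !inE /= => iS jS ij; apply/eqP; apply: contraT => ne.
  have [|c _ cB] := trace [set i]%SET; first by rewrite finset.sub1set.
  have := cB j jS; rewrite -ij -cB// !finset.inE eqxx eq_sym.
  by rewrite (negbTE ne).
apply: (VC (q @` [set` S])).
  by apply: card_eq_trans (inj_card_eq qinj) _; exact: card_eq_fintype_set.
move=> S' S'sub; have [|c Cc cB] := trace (finset (fun i => (i \in S) && `[< S' (q i) >])).
  by apply/fintype.subsetP => i; rewrite finset.inE => /andP[].
exists c => //; apply/seteqP; split=> [x [[i /= iS <-] cx]|x S'x].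
  have := cB i iS; rewrite finset.inE iS/= => E.
  by apply/asboolP; rewrite E; apply/asboolP.
have [i /= iS ix] := S'sub x S'x; split; first by exists i.
have := cB i iS; rewrite finset.inE iS/= => E.
by rewrite -ix; apply/asboolP; rewrite -E; apply/asboolP; rewrite ix.
Qed.

(** * Bounded measurable functions *)

(** Such functions are integrable for every probability, so means are real numbers and linearity
    carries no further integrability condition. *)
Definition bounded_measurable (R : realType) d (T : measurableType d)
  (f : T -> R) := measurable_fun setT f /\ exists M, forall x, `|f x| <= M.

Section BoundedMeasurable.
Context {R : realType}.

Lemma bm_cst d (T : measurableType d) (c : R) : bounded_measurable (fun _ : T => c).
Proof. by split; [exact: measurable_cst|exists `|c|]. Qed.

Lemma bmD d (T : measurableType d) (f g : T -> R) : bounded_measurable f ->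
  bounded_measurable g -> bounded_measurable (fun x => f x + g x).
Proof.
move=> [mf [M fM]] [mg [N gN]]; split; first exact: measurable_funD.
by exists (M + N) => x; rewrite (le_trans (ler_normD _ _))// lerD.
Qed.

Lemma bmM d (T : measurableType d) (f g : T -> R) : bounded_measurable f ->
  bounded_measurable g -> bounded_measurable (fun x => f x * g x).
Proof.
move=> [mf [M fM]] [mg [N gN]]; split; first exact: measurable_funM.
by exists (M * N) => x; rewrite normrM ler_pM.
Qed.

Lemma bmZ d (T : measurableType d) (c : R) (f : T -> R) : bounded_measurable f ->
  bounded_measurable (fun x => c * f x).
Proof. by move=> bf; apply: bmM => //; exact: bm_cst. Qed.

Lemma bmB d (T : measurableType d) (f g : T -> R) : bounded_measurable f ->
  bounded_measurable g -> bounded_measurable (fun x => f x - g x).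
Proof.
move=> bf bg; rewrite (_ : (fun x => _) = (fun x => f x + (-1) * g x)).
  by apply: bmD => //; exact: bmZ.
by apply/funext => x; rewrite mulN1r.
Qed.

Lemma bm_sum d (T : measurableType d) (I : Type) (r : seq I) (P : pred I)
    (f : I -> T -> R) : (forall i, bounded_measurable (f i)) ->
  bounded_measurable (fun x => \sum_(i <- r | P i) f i x).
Proof.
move=> bf; elim: r => [|i r IH].
  by under eq_fun do rewrite big_nil; exact: bm_cst.
under eq_fun do rewrite big_cons; case: (P i) => //.
exact: bmD.
Qed.

Lemma bm_expR d (T : measurableType d) (f : T -> R) : bounded_measurable f ->
  bounded_measurable (fun x => expR (f x)).
Proof.
move=> [mf [M fM]]; split; first exact: measurableT_comp.
exists (expR M) => x; rewrite ger0_norm ?expR_ge0// ler_expR.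
exact: le_trans (ler_norm _) (fM x).
Qed.

Lemma bm_comp d d' (T : measurableType d) (T' : measurableType d')
    (f : T' -> R) (g : T -> T') : bounded_measurable f ->
  measurable_fun setT g -> bounded_measurable (fun x => f (g x)).
Proof.
move=> [mf [M fM]] mg; split; first exact: (measurableT_comp mf mg).
by exists M => x; exact: fM.
Qed.

Lemma bm_indic d (T : measurableType d) (A : set T) : measurable A ->
  bounded_measurable (fun x => \1_A x : R).
Proof.
move=> mA; split; first exact: measurable_indic.
by exists 1 => x; rewrite indicE normr_nat (ler_nat _ _ 1) leq_b1.
Qed.

Section Mean.
Context d (T : measurableType d) (Q : probability T R).
Implicit Types f g : T -> R.

Lemma bm_integrable f : bounded_measurable f -> Q.-integrable setT (EFin \o f).
Proof.
move=> [mf [M fM]]; apply: measurable_bounded_integrable => //.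
  by rewrite (@le_lt_trans _ _ 1%E) ?ltry// probability_le1.
exists M; split; first exact: num_real.
by move=> N MN x _; apply: le_trans (fM x) _; exact: ltW.
Qed.

Lemma EFin_mean f : bounded_measurable f ->
  (\int[Q]_x (f x)%:E)%E = (\int[Q]_x f x)%:E.
Proof.
by move=> bf; rewrite fineK//; apply: integrable_fin_num => //; exact: bm_integrable.
Qed.

Lemma mean_cst (c : R) : \int[Q]_x c = c.
Proof. by rewrite Rintegral_cst// [X in fine X](_ : _ = 1%E) ?mulr1//; exact: probability_setT. Qed.

Lemma meanD f g : bounded_measurable f -> bounded_measurable g ->
  \int[Q]_x (f x + g x) = \int[Q]_x f x + \int[Q]_x g x.
Proof. by move=> bf bg; apply: RintegralD => //; exact: bm_integrable. Qed.

Lemma meanB f g : bounded_measurable f -> bounded_measurable g ->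
  \int[Q]_x (f x - g x) = \int[Q]_x f x - \int[Q]_x g x.
Proof. by move=> bf bg; apply: RintegralB => //; exact: bm_integrable. Qed.

Lemma meanZ c f : bounded_measurable f ->
  \int[Q]_x (c * f x) = c * \int[Q]_x f x.
Proof. by move=> bf; apply: RintegralZl => //; exact: bm_integrable. Qed.

Lemma mean_sum (I : Type) (r : seq I) (P : pred I) (f : I -> T -> R) :
  (forall i, bounded_measurable (f i)) ->
  \int[Q]_x (\sum_(i <- r | P i) f i x) = \sum_(i <- r | P i) \int[Q]_x f i x.
Proof.
move=> bf; elim: r => [|i r IH].
  rewrite big_nil; under eq_Rintegral do rewrite big_nil.
  exact: mean_cst.
rewrite big_cons; under eq_Rintegral do rewrite big_cons.
case: (P i) => //; rewrite -IH; apply: meanD => //; exact: bm_sum.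
Qed.

Lemma mean_le f g : bounded_measurable f -> bounded_measurable g ->
  (forall x, f x <= g x) -> \int[Q]_x f x <= \int[Q]_x g x.
Proof. by move=> bf bg fg; apply: le_Rintegral => //; exact: bm_integrable. Qed.

Lemma norm_mean_le f M : bounded_measurable f -> (forall x, `|f x| <= M) ->
  `|\int[Q]_x f x| <= M.
Proof.
move=> bf fM; rewrite ler_norml -(mean_cst (- M)) -[X in _ && (_ <= X)](mean_cst M).
apply/andP; split; apply: mean_le => //; try exact: bm_cst; move=> x;
  by have := fM x; rewrite ler_norml => /andP[].
Qed.

Lemma mean_indic (A : set T) : measurable A -> (\int[Q]_x \1_A x)%:E = Q A.
Proof.
by move=> mA; rewrite -EFin_mean; [rewrite integral_indic// setIT|exact: bm_indic].
Qed.

Lemma eq_mean_measure (Q' : probability T R) f : bounded_measurable f ->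
  (forall A, measurable A -> Q A = Q' A) -> \int[Q]_x f x = \int[Q']_x f x.
Proof.
by move=> bf QQ'; congr fine; apply: eq_measure_integral => A mA _; exact: QQ'.
Qed.

End Mean.

Lemma mean_distribution d d' (T : measurableType d) (T' : measurableType d')
    (P : probability T R) (X : {RV P >-> T'}) (f : T' -> R) :
  bounded_measurable f -> \int[distribution P X]_y f y = \int[P]_x f (X x).
Proof.
move=> bf; congr fine; rewrite integral_distribution//.
  by apply/measurable_EFinP; exact: bf.1.
by apply: (bm_integrable P (f := fun x => f (X x))); apply: bm_comp.
Qed.

Section Fubini.
Context d1 d2 (T1 : measurableType d1) (T2 : measurableType d2).
Context (P : probability T1 R) (Q : probability T2 R).

Lemma bm_fubini (f : T1 * T2 -> R) : bounded_measurable f ->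
  bounded_measurable (fun x => \int[Q]_y f (x, y)).
Proof.
move=> bf; split; last first.
  case: (bf) => mf [M fM]; exists M => x; apply: norm_mean_le => //.
  exact: bm_comp.
have := measurable_fubini_F (bm_integrable (P \x Q)%E bf).
by move=> m; exact: (measurableT_comp (fine_measurable (R := R) measurableT) m).
Qed.

Lemma mean_fubini (f : T1 * T2 -> R) : bounded_measurable f ->
  \int[(P \x Q)%E]_z f z = \int[P]_x \int[Q]_y f (x, y).
Proof.
move=> bf; apply: EFin_inj.
transitivity (\int[P]_x fubini_F Q (EFin \o f) x)%E.
  rewrite integral12_prod_meas1; last exact: bm_integrable.
  by rewrite -(EFin_mean (P \x Q)%E bf).
rewrite -EFin_mean; last exact: bm_fubini.
apply: eq_integral => x _; rewrite /fubini_F -EFin_mean//.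
exact: (bm_comp bf).
Qed.

End Fubini.
End BoundedMeasurable.

(** * Laws of i.i.d. tuples *)

Section IidTuples.
Context {R : realType} {d d' : measure_display}.
Context {Omega : measurableType d} {T : measurableType d'}.
Context (P : probability Omega R) (mu : probability T R).

Definition mfun_of (d1 d2 : measure_display) (T1 : measurableType d1)
    (T2 : measurableType d2) (f : T1 -> T2) (mf : measurable_fun setT f) :
    {mfun T1 >-> T2} := mfun_Sub (mem_set mf).

Lemma measurable_tuple_box n (E : 'I_n -> set T) : (forall i, measurable (E i)) ->
  measurable [set t : n.-tuple T | forall i, E i (tnth t i)].
Proof.
move=> mE; rewrite (_ : [set t | _] =
    \big[setI/setT]_(i < n) ((@tnth n T ^~ i) @^-1` E i)).
  apply: bigsetI_measurable => i _; rewrite -[X in measurable X]setTI.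
  exact: measurable_tnth.
rewrite -bigcap_seq; apply/seteqP; split=> [t H i _|t H i]; first exact: H.
by apply: H; rewrite /= mem_index_enum.
Qed.

(** Boxes are stable under intersection and generate the sigma-algebra of the tuple space. *)
Lemma measure_tuple_unique n (m1 m2 : {measure set (n.-tuple T) -> \bar R}) :
  (m1 setT < +oo)%E ->
  (forall E : 'I_n -> set T, (forall i, measurable (E i)) ->
    m1 [set t | forall i, E i (tnth t i)] = m2 [set t | forall i, E i (tnth t i)]) ->
  forall A, measurable A -> m1 A = m2 A.
Proof.
move=> fin boxE.
pose G : set (set (n.-tuple T)) := [set A | exists E : 'I_n -> set T,
  (forall i, measurable (E i)) /\ A = [set t | forall i, E i (tnth t i)]].
have GT : G setT.
  by exists (fun=> setT); split => //; apply/seteqP; split.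
have mG : measurable = <<s G >> :> set (set (n.-tuple T)).
  apply/seteqP; split.
    apply: smallest_sub; first exact: smallest_sigma_algebra.
    rewrite -bigcup_seq => A [i /= _ [E mE <-]].
    apply: sub_sigma_algebra; exists (fun j => if j == i then E else setT).
    split=> [j|]; first by case: ifP.
    apply/seteqP; split=> [t [_ /= Et] j|t /= H]; first by case: eqP => // ->.
    by split => //; have := H i; rewrite eqxx.
  apply: smallest_sub; first exact: sigma_algebra_measurable.
  move=> _ [E [mE ->]].
  exact: measurable_tuple_box.
move=> A mA; apply: (measure_unique G (fun=> setT)) => //.
- move=> _ _ [E [mE ->]] [F [mF ->]].
  exists (fun i => E i `&` F i); split=> [i|]; first exact: measurableI.
  apply/seteqP; split=> [t [Et Ft] i|t H]; first by split.
  by split=> i; have [] := H i.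
- by rewrite bigcup_const.
- by move=> _ [E [mE ->]]; exact: boxE.
Qed.

Context (D : nat -> {RV P >-> T}) (D_iid : iid mu D).

Lemma iid_box (I : finType) (a : I -> nat) (E : I -> set T) : injective a ->
  (forall i, measurable (E i)) ->
  P [set omega | forall i, E i (D (a i) omega)] = (\prod_i mu (E i))%E.
Proof.
move=> ainj mE.
pose F k := if [pick i | a i == k] is Some i then E i else setT.
have Fa i : F (a i) = E i.
  rewrite /F; case: pickP => [j /eqP /ainj ->//|/(_ i)]; by rewrite eqxx.
have mF k : measurable (F k) by rewrite /F; case: pickP.
pose J := seq_fset tt (map a (enum I)).
have := D_iid.2 J F mF.
have -> : \bigcap_(i in [set` J]) (D i @^-1` F i) =
    [set omega | forall i, E i (D (a i) omega)].
  apply/seteqP; split=> [w H i|w H k /=].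
    by rewrite -Fa; apply: H; rewrite /= seq_fsetE map_f// mem_enum.
  by rewrite seq_fsetE => /mapP[i _ ->]; rewrite /preimage/= Fa; exact: H.
move=> ->; rewrite (perm_big (map a (enum I))); last first.
  apply: uniq_perm; [exact: fset_uniq|by rewrite map_inj_uniq// enum_uniq|].
  by move=> k; rewrite seq_fsetE.
rewrite big_map big_enum/=; apply: eq_bigr => i _.
by rewrite Fa -(D_iid.1 (a i)).
Qed.

Definition sample_tuple n (a : 'I_n -> nat) (omega : Omega) : n.-tuple T :=
  [tuple D (a i) omega | i < n].

Lemma measurable_sample_tuple n (a : 'I_n -> nat) :
  measurable_fun setT (sample_tuple a).
Proof.
apply/measurable_fun_tnthP => i.
rewrite (_ : _ \o _ = D (a i)); first exact: measurable_funPT.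
by apply/funext => w; rewrite /= tnth_mktuple.
Qed.

Definition tuple_law n (a : 'I_n -> nat) : probability (n.-tuple T) R :=
  distribution P (mfun_of (measurable_sample_tuple a)).

Lemma tuple_law_box n (a : 'I_n -> nat) (E : 'I_n -> set T) : injective a ->
  (forall i, measurable (E i)) ->
  tuple_law a [set t | forall i, E i (tnth t i)] = (\prod_i mu (E i))%E.
Proof.
move=> ainj mE; rewrite -(iid_box ainj mE); congr (P _).
by apply/seteqP; split=> w /= H i; have := H i; rewrite tnth_mktuple.
Qed.

Lemma tuple_law_unique n (a b : 'I_n -> nat) : injective a -> injective b ->
  forall A, measurable A -> tuple_law a A = tuple_law b A.
Proof.
move=> ia ib; apply: measure_tuple_unique.
  by rewrite (@le_lt_trans _ _ 1%E) ?ltry// probability_le1.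
by move=> E mE; exact: etrans (tuple_law_box ia mE) (esym (tuple_law_box ib mE)).
Qed.

(** For a fixed event [B] both sides are finite measures in [A], so boxes decide. Using this once
    for each of two tuples gives their independence. *)
Lemma tuple_law_cond n (a : 'I_n -> nat) (B : set Omega) : measurable B ->
  (forall E : 'I_n -> set T, (forall i, measurable (E i)) ->
    let A := [set t | forall i, E i (tnth t i)] in
    P (sample_tuple a @^-1` A `&` B) = (P B * tuple_law a A)%E) ->
  forall A, measurable A ->
    P (sample_tuple a @^-1` A `&` B) = (P B * tuple_law a A)%E.
Proof.
move=> mB boxE A mA.
have PB0 : 0 <= fine (P B) by rewrite fine_ge0.
have PBE : P B = (fine (P B))%:E.
  by rewrite fineK// fin_num_measure.
pose m1 := pushforward (mrestr P mB) (mfun_of (measurable_sample_tuple a)).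
pose m2 := mscale (NngNum PB0) (tuple_law a).
have E2 C : m2 C = (P B * tuple_law a C)%E by rewrite PBE.
rewrite -E2; apply: (@measure_tuple_unique n m1 m2) => //.
  have m1T : m1 setT = P (setT `&` B) by [].
  by apply: (@le_lt_trans _ _ (P (setT `&` B))); rewrite ?m1T// setTI PBE ltry.
by move=> E mE; apply: etrans (esym (E2 _)); exact: boxE.
Qed.

Lemma tuple_law_indep n (a b : 'I_n -> nat) : injective a -> injective b ->
  (forall i j, a i != b j) ->
  forall A A', measurable A -> measurable A' ->
    P (sample_tuple a @^-1` A `&` sample_tuple b @^-1` A') =
    (tuple_law a A * tuple_law b A')%E.
Proof.
move=> ia ib ab A A' mA mA'.
have mpre c (C : set (n.-tuple T)) : measurable C -> measurable (sample_tuple c @^-1` C).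
  by move=> mC; rewrite -[X in measurable X]setTI; exact: measurable_sample_tuple.
rewrite setIC; apply: (tuple_law_cond (mpre a A mA)) => // E mE B.
rewrite setIC muleC; apply: (tuple_law_cond (mpre b B (measurable_tuple_box mE))) => // F mF C.
(* For boxes on both sides the claim is the product formula over the [2 n] distinct indices taken by
   [a] and [b] together. *)
pose c (p : 'I_n * bool) := if p.2 then a p.1 else b p.1.
pose G (p : 'I_n * bool) := if p.2 then F p.1 else E p.1.
have ic : injective c.
  move=> [i []] [j []]; rewrite /c/=; first by move=> /ia ->.
  - by move=> /eqP; rewrite (negbTE (ab i j)).
  - by move=> /eqP; rewrite eq_sym (negbTE (ab j i)).
  - by move=> /ib ->.
have mG p : measurable (G p) by rewrite /G; case: ifP.
have := iid_box ic mG.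
rewrite (_ : [set w | _] = sample_tuple a @^-1` C `&` sample_tuple b @^-1` B); last first.
  apply/seteqP; split=> [w H|w [Ha Hb] [i []]]; last 2 first.
  - by have := Ha i; rewrite tnth_mktuple.
  - by have := Hb i; rewrite tnth_mktuple.
  by split=> i; rewrite tnth_mktuple; [exact: (H (i, true))|exact: (H (i, false))].
move=> ->; rewrite -[P _]/(tuple_law b B) (tuple_law_box ib mE) (tuple_law_box ia mF).
rewrite muleC -(pair_big predT predT (fun i b => mu (G (i, b))))/=.
rewrite -big_split/=; apply: eq_bigr => i _.
by rewrite big_bool.
Qed.

Lemma mean_sample_pair n (a b : 'I_n -> nat) (f : n.-tuple T * n.-tuple T -> R) :
  injective a -> injective b -> (forall i j, a i != b j) ->
  bounded_measurable f ->
  \int[P]_w f (sample_tuple a w, sample_tuple b w) =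
  \int[(tuple_law a \x tuple_law b)%E]_z f z.
Proof.
move=> ia ib ab bf.
have mab : measurable_fun setT (fun w => (sample_tuple a w, sample_tuple b w)).
  by apply/measurable_fun_pair; exact: measurable_sample_tuple.
rewrite -(mean_distribution (P := P) (mfun_of mab) bf).
apply: eq_mean_measure => // A mA.
apply/esym; apply: product_measure_unique => // C C' mC mC'.
exact: tuple_law_indep.
Qed.

Lemma mean_sample_coords n (a : 'I_n -> nat) i j (f : T * T -> R) :
  injective a -> i != j -> bounded_measurable f ->
  \int[tuple_law a]_t f (tnth t i, tnth t j) = \int[(mu \x mu)%E]_z f z.
Proof.
move=> ia ij bf.
have mt : measurable_fun setT (fun t : n.-tuple T => (tnth t i, tnth t j)).
  by apply/measurable_fun_pair; exact: measurable_tnth.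
rewrite -(mean_distribution (P := tuple_law a) (mfun_of mt) bf).
apply: eq_mean_measure => // A mA.
apply/esym; apply: product_measure_unique => // C C' mC mC'.
pose E k := if k == i then C else if k == j then C' else setT.
have mE k : measurable (E k) by rewrite /E; case: ifP => // _; case: ifP.
transitivity (\prod_k mu (E k))%E; last first.
  rewrite (bigD1 i)//= (bigD1 j)/=; last by rewrite eq_sym.
  rewrite big1 ?mule1; last first.
    by move=> k /andP[ki kj]; rewrite /E (negbTE ki) (negbTE kj) probability_setT.
  by rewrite /E !eqxx eq_sym (negbTE ij).
rewrite -(tuple_law_box ia mE); congr (P _).
apply/seteqP; split=> w /=.
  by move=> [Ci C'j] k; rewrite /E; case: eqP => [->//|_]; case: eqP => [->//|].
move=> H; split; first by have := H i; rewrite /E eqxx.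
by have := H j; rewrite /E eq_sym (negbTE ij) eqxx.
Qed.

End IidTuples.

(** * Symmetrization of U-statistics *)

Definition ustat (R : realType) (T : Type) n (u : T * T -> R) (t : n.-tuple T) : R :=
  (n%:R * (n%:R - 1))^-1 *
  \sum_(i < n) \sum_(j < n | j != i) u (tnth t i, tnth t j).

Section Symmetrization.
Context {R : realType} {d d' : measure_display}.
Context {Omega : measurableType d} {T : measurableType d'}.
Context (P : probability Omega R) (mu : probability T R).
Context (D : nat -> {RV P >-> T}) (D_iid : iid mu D).

Lemma cube_average_bm (F : (nat -> bool) -> Omega -> R) n s :
  (forall s, bounded_measurable (F s)) ->
  bounded_measurable (fun w => cube_average n (fun s => F s w) s).
Proof.
move=> bF; elim: n s => [|n IH] s //=.
rewrite /coord_average (_ : (fun w => _) = (fun w => 2^-1 *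
  (cube_average n (fun s => F s w) (flip_to s n true) +
   cube_average n (fun s => F s w) (flip_to s n false)))).
  by apply: bmZ; apply: bmD.
by apply/funext => w; rewrite mulrC.
Qed.

Lemma cube_average_mean (F : (nat -> bool) -> Omega -> R) n s :
  (forall s, bounded_measurable (F s)) ->
  \int[P]_w cube_average n (fun s => F s w) s =
  cube_average n (fun s => \int[P]_w F s w) s.
Proof.
move=> bF; elim: n s => [|n IH] s //=.
rewrite /coord_average -!IH.
under eq_Rintegral do rewrite mulrC.
by rewrite meanZ ?meanD ?(mulrC 2^-1)//; [exact: cube_average_bm..|
  apply: bmD; exact: cube_average_bm].
Qed.

Lemma cube_average_ext n (F G : (nat -> bool) -> R) s :
  (forall s, F s = G s) -> cube_average n F s = cube_average n G s.
Proof. by move=> FG; congr cube_average; apply/funext. Qed.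

Context (n : nat) (n2 : (2 <= n)%N).

Lemma mean_ustat (a : 'I_n -> nat) (u : T * T -> R) : injective a ->
  bounded_measurable u ->
  \int[tuple_law D a]_t ustat u t = \int[(mu \x mu)%E]_z u z.
Proof.
move=> ia bu.
have b2 i j : bounded_measurable (fun t : n.-tuple T => u (tnth t i, tnth t j)).
  by apply: bm_comp => //; apply/measurable_fun_pair; exact: measurable_tnth.
rewrite /ustat meanZ; last by apply: bm_sum => i; apply: bm_sum => j.
rewrite mean_sum => [|i]; last by apply: bm_sum => j.
under eq_bigr => i _ do rewrite mean_sum//.
under eq_bigr => i _.
  under eq_bigr => j ji do rewrite (mean_sample_coords D_iid ia _ bu) 1?eq_sym//.
  over.
exact: ustat_weight_sum.
Qed.

Context (h : n.-tuple T -> T * T -> R).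
Context (bh : bounded_measurable (fun p : n.-tuple T * (T * T) => h p.1 p.2)).

Definition pick_tuple (A : Type) (z : 'I_n * bool -> A) (s : nat -> bool) : n.-tuple A :=
  [tuple z (i, s i) | i < n].

(* Introducing a second sample inside the expectation (Jensen) and averaging
   over all exchanges of X_i with its copy bounds the exponential moment by a
   quantity in which the 2n points are fixed. *)
Lemma symmetrization (l K : R) :
  (forall (z : 'I_n * bool -> T) s0, cube_average n (fun s => expR (l *
     (ustat (h (pick_tuple z s)) (pick_tuple z (fun i => ~~ s i)) -
      ustat (h (pick_tuple z s)) (pick_tuple z s)))) s0 <= K) ->
  \int[P]_w expR (l * (\int[(mu \x mu)%E]_z h (sample_tuple D (fun i : 'I_n => i) w) z -
     ustat (h (sample_tuple D (fun i : 'I_n => i) w))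
       (sample_tuple D (fun i : 'I_n => i) w))) <= K.
Proof.
move=> HK.
pose a0 (i : 'I_n) : nat := i.
have ia0 : injective a0 by move=> i j /val_inj.
pose nu := tuple_law D a0.
have bhs t : bounded_measurable (h t) by exact: (bm_comp bh (pair1_measurable t)).
have bU : bounded_measurable (fun p : n.-tuple T * n.-tuple T => ustat (h p.1) p.2).
  apply: bmZ; apply: bm_sum => i; apply: bm_sum => j.
  apply: (bm_comp bh (g := fun p : n.-tuple T * n.-tuple T =>
    (p.1, (tnth p.2 i, tnth p.2 j)))).
  apply/measurable_fun_pair => //; apply/measurable_fun_pair => //=.
    by apply: (measurableT_comp (measurable_tnth i)).
  by apply: (measurableT_comp (measurable_tnth j)).
have bU0 : bounded_measurable (fun t => ustat (h t) t).
  by apply: (bm_comp bU (g := fun t => (t, t))); exact/measurable_fun_pair.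
have bA : bounded_measurable (fun t => \int[(mu \x mu)%E]_z h t z).
  exact: (bm_fubini nu (mu \x mu)%E bh).
pose Phi t := expR (l * (\int[(mu \x mu)%E]_z h t z - ustat (h t) t)).
have bPhi : bounded_measurable Phi by apply: bm_expR; apply: bmZ; exact: bmB.
pose G (p : n.-tuple T * n.-tuple T) :=
  expR (l * (ustat (h p.1) p.2 - ustat (h p.1) p.1)).
have bG : bounded_measurable G.
  apply: bm_expR; apply: bmZ; apply: bmB => //.
  exact: (bm_comp bU0).
have jensen t : Phi t <= \int[nu]_t' G (t, t').
  have bUt : bounded_measurable (fun t' : n.-tuple T => ustat (h t) t').
    exact: (bm_comp bU (pair1_measurable t)).
  set m := \int[(mu \x mu)%E]_z h t z.
  have mE : \int[nu]_t' ustat (h t) t' = m by exact: mean_ustat.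
  (* Jensen through the tangent line of the exponential at the mean [m]: the linear term integrates
     to zero. *)
  have -> : Phi t = \int[nu]_t' (Phi t * (1 + l * (ustat (h t) t' - m))).
    rewrite meanZ; last by apply: bmD; [exact: bm_cst|apply: bmZ; apply: bmB => //; exact: bm_cst].
    rewrite meanD; [|exact: bm_cst|by apply: bmZ; apply: bmB => //; exact: bm_cst].
    rewrite mean_cst meanZ; last by apply: bmB => //; exact: bm_cst.
    rewrite meanB//; last exact: bm_cst.
    by rewrite mean_cst mE subrr mulr0 addr0 mulr1.
  apply: mean_le.
  - by apply: bmZ; apply: bmD; [exact: bm_cst|apply: bmZ; apply: bmB => //; exact: bm_cst].
  - exact: (bm_comp bG (pair1_measurable t)).
  move=> t'; rewrite /G /Phi/= -/m.
  rewrite (_ : l * (ustat (h t) t' - ustat (h t) t) =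
    l * (m - ustat (h t) t) + l * (ustat (h t) t' - m)); last by ring.
  by rewrite expRD ler_wpM2l ?expR_ge0// expR_ge1Dx.
rewrite -[leLHS]/(\int[P]_w Phi (sample_tuple D a0 w)).
rewrite -(mean_distribution (P := P) (mfun_of (measurable_sample_tuple D a0)) bPhi).
rewrite -/nu; apply: (@le_trans _ _ (\int[(nu \x nu)%E]_p G p)).
  rewrite mean_fubini//; apply: mean_le => //; exact: bm_fubini.
(* Indices [i] and [n + i] carry an observation and its copy. Bit [s i] selects between them, so
   [idx s] and [idx] of the complement are disjoint. *)
pose idx (s : nat -> bool) (i : 'I_n) : nat := (s i * n + i)%N.
have iidx s : injective (idx s).
  move=> i j; rewrite /idx => E; apply: val_inj.
  have := congr1 (modn^~ n) E.
  by rewrite !modnMDl !modn_small.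
have didx s i j : idx s i != idx (fun k => ~~ s k) j.
  apply/eqP => E; have := congr1 (modn^~ n) E; have := congr1 (divn^~ n) E.
  have n0 : (0 < n)%N by exact: ltnW.
  rewrite /idx !divnMDl// !divn_small// !modnMDl !modn_small// !addn0.
  by move=> /[swap] /val_inj ->; case: (s j).
(* Every exchange preserves the product law, so averaging over [s] inside the expectation changes
   nothing. *)
have swapE s : \int[P]_w G (sample_tuple D (idx s) w,
    sample_tuple D (idx (fun k => ~~ s k)) w) = \int[(nu \x nu)%E]_p G p.
  rewrite (mean_sample_pair D_iid)//.
  apply: eq_mean_measure => // A mA; apply: product_measure_unique => // C C' mC mC'.
  apply: (etrans (product_measure1E nu nu mC mC')).
  by congr (_ * _)%E; exact: (tuple_law_unique D_iid).
pose F s w := G (sample_tuple D (idx s) w, sample_tuple D (idx (fun k => ~~ s k)) w).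
have bF s : bounded_measurable (F s).
  apply: (bm_comp bG); apply/measurable_fun_pair; exact: measurable_sample_tuple.
pose s0 : nat -> bool := fun=> false.
have -> : \int[(nu \x nu)%E]_p G p =
    \int[P]_w cube_average n (fun s => F s w) s0.
  rewrite cube_average_mean//.
  under cube_average_ext => s do rewrite swapE.
  by rewrite cube_average_cst.
rewrite -[leRHS](mean_cst P); apply: mean_le; [exact: cube_average_bm|exact: bm_cst|].
move=> w; pose z (p : 'I_n * bool) := D (p.2 * n + p.1)%N w.
by have := HK z s0.
Qed.

End Symmetrization.

(** * Deviations of U-statistics *)

Section Tails.
Context {R : realType} {d d' : measure_display}.
Context {Omega : measurableType d} {T : measurableType d'}.
Context (P : probability Omega R) (mu : probability T R).
Context (D : nat -> {RV P >-> T}) (D_iid : iid mu D).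

Lemma expR_tail (Y : Omega -> R) (l e K : R) : bounded_measurable Y -> 0 <= l ->
  \int[P]_w expR (l * Y w) <= K ->
  (P [set w | (e < Y w)%R] <= (expR (- (l * e)) * K)%:E)%E.
Proof.
move=> bY l0 HK.
have mE : measurable [set w | e < Y w].
  rewrite (_ : [set w | _] = Y @^-1` `]e, +oo[); last first.
    by apply/seteqP; split=> w /=; rewrite in_itv/= andbT.
  by rewrite -[X in measurable X]setTI; exact: bY.1.
rewrite -mean_indic// lee_fin; apply: (@le_trans _ _
  (\int[P]_w (expR (- (l * e)) * expR (l * Y w)))).
  apply: mean_le; [exact: bm_indic|by apply/bmZ/bm_expR/bmZ|].
  move=> w; rewrite -expRD -mulrN -mulrDr indicE.
  have [|_] := boolP (w \in _); last by rewrite expR_ge0.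
  rewrite inE /= => eY; rewrite -[leLHS]/(1 : R) -expR0 ler_expR.
  by rewrite mulr_ge0// addrC subr_ge0 ltW.
rewrite meanZ; last by apply/bm_expR/bmZ.
by rewrite ler_wpM2l// expR_ge0.
Qed.

Lemma swap_deviation_ustat n (A : Type) (u : A * A -> R) (z : 'I_n * bool -> A) s :
  ustat u (pick_tuple z (fun i => ~~ s i)) - ustat u (pick_tuple z s) =
  swap_deviation (fun p => u (z p.1, z p.2)) s.
Proof.
rewrite /ustat -mulrBr -sumrB; congr (_ * _); apply: eq_bigr => i _.
by rewrite -sumrB; apply: eq_bigr => j _; rewrite !tnth_mktuple.
Qed.

Local Notation sample n := (sample_tuple D (fun i : 'I_n => i : nat)).

Lemma bm_ustat_sample n (h : n.-tuple T -> T * T -> R) :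
  bounded_measurable (fun p : n.-tuple T * (T * T) => h p.1 p.2) ->
  bounded_measurable (fun w => ustat (h (sample n w)) (sample n w)).
Proof.
move=> bh; apply: (bm_comp (f := fun t => ustat (h t) t)); last first.
  exact: measurable_sample_tuple.
apply: bmZ; apply: bm_sum => i; apply: bm_sum => j.
apply: (bm_comp bh (g := fun t : n.-tuple T => (t, (tnth t i, tnth t j)))).
apply/measurable_fun_pair => //; apply/measurable_fun_pair => //=; exact: measurable_tnth.
Qed.

Lemma bm_mean_sample n (h : n.-tuple T -> T * T -> R) :
  bounded_measurable (fun p : n.-tuple T * (T * T) => h p.1 p.2) ->
  bounded_measurable (fun w => \int[(mu \x mu)%E]_z h (sample n w) z).
Proof.
move=> bh; apply: (bm_comp (f := fun t => \int[(mu \x mu)%E]_z h t z)); last first.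
  exact: measurable_sample_tuple.
exact: (bm_fubini (tuple_law D (fun i : 'I_n => i : nat)) (mu \x mu)%E bh).
Qed.

(** Symmetrization bounds mean minus statistic; the opposite direction comes from applying it to
    [M - u], a kernel that ignores the sample. The chosen [l] minimizes [- l e + 8 M^2 l^2 / n]. *)
Lemma ustat_tail (u : T * T -> R) M n e : (2 <= n)%N -> 0 < M -> 0 < e ->
  measurable_fun setT u -> (forall z, 0 <= u z <= M) ->
  (P [set w | (e < ustat u (sample n w) - \int[(mu \x mu)%E]_z u z)%R] <=
    (expR (- (n%:R * (e ^+ 2 / (32 * M ^+ 2)))))%:E)%E.
Proof.
move=> n2 M0 e0 mu_ uM.
have bu : bounded_measurable u.
  by split => //; exists M => z; have /andP[u0 uM'] := uM z; rewrite ger0_norm.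
pose v z := M - u z.
have bv : bounded_measurable v by apply: bmB => //; exact: bm_cst.
pose h (t : n.-tuple T) := v.
have bh : bounded_measurable (fun p : n.-tuple T * (T * T) => h p.1 p.2).
  exact: (bm_comp bv (g := snd)).
pose l := n%:R * e / (16 * M ^+ 2).
have n0 : 0 < n%:R :> R by rewrite ltr0n ltnW.
have l0 : 0 <= l by rewrite divr_ge0 ?mulr_ge0// ltW// exprn_gt0.
pose K := expR (8 * M ^+ 2 * l ^+ 2 / n%:R).
have sym : \int[P]_w expR (l * (\int[(mu \x mu)%E]_z h (sample n w) z -
    ustat (h (sample n w)) (sample n w))) <= K.
  apply: (symmetrization D_iid n2 bh) => z s0.
  rewrite (_ : (fun s => _) = (fun s => expR (l * swap_deviation
    (fun p => v (z p.1, z p.2)) s))); last first.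
    by apply/funext => s; rewrite swap_deviation_ustat.
  apply: swap_deviation_mgf => //; first exact: ltW.
  by move=> p; have /andP[? ?] := uM (z p.1, z p.2); rewrite /v; apply/andP; split; lra.
have := expR_tail e (bmB (bm_mean_sample bh) (bm_ustat_sample bh)) l0 sym.
rewrite -expRD (_ : - (l * e) + 8 * M ^+ 2 * l ^+ 2 / n%:R =
  - (n%:R * (e ^+ 2 / (32 * M ^+ 2)))); last first.
  by rewrite /l; field; rewrite !gt_eqF.
move=> tail; rewrite (_ : [set w | _] = [set w | e < \int[(mu \x mu)%E]_z h (sample n w) z -
  ustat (h (sample n w)) (sample n w)])//.
suff E w : ustat u (sample n w) - \int[(mu \x mu)%E]_z u z =
    \int[(mu \x mu)%E]_z h (sample n w) z - ustat (h (sample n w)) (sample n w).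
  by apply/seteqP; split=> w /=; rewrite E.
rewrite meanB ?mean_cst//; last exact: bm_cst.
have -> : ustat v (sample n w) = M - ustat u (sample n w).
  rewrite -(ustat_weight_sum M n2) -mulrBr -sumrB; congr (_ * _).
  by apply: eq_bigr => i _; rewrite -sumrB.
by ring.
Qed.

End Tails.

(** * Margin losses and the deviation for a data-dependent combination *)

Section Margins.
Context {d : measure_display} {X : measurableType d} {R : realType}.
Local Notation Z := (X * R)%type.

Lemma measurable_half_diff :
  measurable_fun setT (fun p : Z * Z => half_diff p.1 p.2).
Proof.
apply: measurable_funM => //; apply: measurable_funB.
  exact: (measurableT_comp measurable_snd measurable_fst).
exact: (measurableT_comp measurable_snd measurable_snd).
Qed.

Lemma bm_sgr_half_diff :
  bounded_measurable (fun p : Z * Z => Num.sg (half_diff p.1 p.2)).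
Proof.
pose hd (p : Z * Z) := half_diff p.1 p.2.
have mpos : measurable [set p | 0 < hd p].
  rewrite (_ : [set p | _] = hd @^-1` `]0, +oo[); last first.
    by apply/seteqP; split=> w /=; rewrite in_itv/= andbT.
  by rewrite -[X in measurable X]setTI; exact: measurable_half_diff.
have mneg : measurable [set p | hd p < 0].
  rewrite (_ : [set p | _] = hd @^-1` `]-oo, 0[); last first.
    by apply/seteqP; split=> w /=; rewrite in_itv.
  by rewrite -[X in measurable X]setTI; exact: measurable_half_diff.
rewrite (_ : (fun p => _) = (fun p => \1_[set p | 0 < hd p] p - \1_[set p | hd p < 0] p)).
  by apply: bmB; exact: bm_indic.
apply/funext => p; rewrite !indicE -/(hd p).
have -> : (p \in [set p | 0 < hd p]) = (0 < hd p) by apply/idP/idP; rewrite inE.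
have -> : (p \in [set p | hd p < 0]) = (hd p < 0) by apply/idP/idP; rewrite inE.
by case: (ltgtP (hd p) 0) => H; rewrite ?(ltr0_sg H) ?(gtr0_sg H) ?H ?sgr0 ?subr0 ?sub0r.
Qed.

Definition instances (p : Z * Z) : X * X := (p.1.1, p.2.1).

Lemma measurable_instances : measurable_fun setT instances.
Proof.
apply/measurable_fun_pair.
  exact: (measurableT_comp measurable_fst measurable_fst).
exact: (measurableT_comp measurable_fst measurable_snd).
Qed.

Definition margin_loss (Psi : R -> R) (q : X * X -> R) (p : Z * Z) : R :=
  Psi (- Num.sg (half_diff p.1 p.2) * q (instances p)).

Lemma measurable_margin_loss Psi (q : X * X -> R) : measurable_fun setT Psi ->
  measurable_fun setT q -> measurable_fun setT (margin_loss Psi q).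
Proof.
move=> mPsi mq; apply: (measurableT_comp mPsi); apply: measurable_funM.
  by apply: measurableT_comp => //; exact: bm_sgr_half_diff.1.
exact: (measurableT_comp mq measurable_instances).
Qed.

Lemma empirical_cost_ustat phi n (s : n.-tuple Z) q :
  empirical_cost phi s q = ustat (margin_loss phi q) s.
Proof. by []. Qed.

Context {d' : measure_display} {Omega : measurableType d'}.
Context (P : probability Omega R) (mu : probability Z R).
Context (D : nat -> {RV P >-> Z}) (D_iid : iid mu D).
Local Notation sample n := (sample_tuple D (fun i : 'I_n => i : nat)).
Context (Rs : set (X * X -> R)) (Rs_rules : forall r, Rs r -> ranking_rule r).
Context (V : nat) (Rs_VC : has_VC_dimension (rule_sets Rs) V).
Context (Psi : R -> R) (L M : R).
Context (Psi_lip : forall x y, `|Psi x - Psi y| <= L * `|x - y|).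
Context (Psi_bnd : forall x, 0 <= Psi x <= M) (M_gt0 : 0 < M).
Context (mPsi : measurable_fun setT Psi).

Lemma bm_joint_margin_loss n (F : n.-tuple Z -> X * X -> R) :
  measurable_fun setT (fun p : n.-tuple Z * (X * X) => F p.1 p.2) ->
  bounded_measurable (fun p : n.-tuple Z * (Z * Z) => margin_loss Psi (F p.1) p.2).
Proof.
move=> mF; split; last first.
  by exists M => p; have /andP[? ?] := Psi_bnd (- Num.sg (half_diff p.2.1 p.2.2) *
    F p.1 (instances p.2)); rewrite /margin_loss ger0_norm.
apply: (measurableT_comp mPsi); apply: measurable_funM.
  apply: measurableT_comp => //.
  exact: (measurableT_comp bm_sgr_half_diff.1 measurable_snd).
apply: (measurableT_comp (g := fun p : n.-tuple Z * (Z * Z) => (p.1, instances p.2)) mF).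
apply/measurable_fun_pair => //.
exact: (measurableT_comp measurable_instances measurable_snd).
Qed.

Lemma combination_pattern_kernel n (z : 'I_n * bool -> Z) b q : combinations Rs b q ->
  pattern_kernel Psi (fun p => - Num.sg (half_diff (z p.1) (z p.2)))
    (patterns (rule_sets Rs) (fun p : ('I_n * bool) * ('I_n * bool) =>
       instances (z p.1, z p.2))) b
    (fun p => margin_loss Psi q (z p.1, z p.2)).
Proof.
move=> [N [w [g [wb gR ->]]]].
exists N, w, (fun j p => g j (instances (z p.1, z p.2))); split => //.
- by move=> j p; have [_] := Rs_rules (gR j); exact.
- move=> j; rewrite finset.inE; apply/asboolP.
  exists [set x | g j x = 1]; first by exists (g j).
  by move=> p; rewrite finset.inE /=; apply/eqP/asboolP.
Qed.

(** With [delta = e / 8] the condition on [k] makes Maurey's error at most [e / 4], and it is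
    counted twice. The remaining exponent [- l e / 2 + 8 M^2 l^2 / n] is minimal at
    [l = n e / (32 M^2)]. The count is over the [4 n^2] pairs formed from [2 n] points. *)
Lemma class_tail n (F : n.-tuple Z -> X * X -> R) b k e :
  (2 <= n)%N -> (0 < k)%N -> 0 < e -> 0 < b ->
  16 * L ^+ 2 * b ^+ 2 <= e ^+ 2 * k%:R ->
  measurable_fun setT (fun p : n.-tuple Z * (X * X) => F p.1 p.2) ->
  (forall s, combinations Rs b (F s)) ->
  (P [set w | (e < \int[(mu \x mu)%E]_z margin_loss Psi (F (sample n w)) z -
      ustat (margin_loss Psi (F (sample n w))) (sample n w))%R] <=
    (expR (- (n%:R * (e ^+ 2 / (128 * M ^+ 2)))) *
     (2 * ((4 * n ^ 2 + 1) ^ V)%:R) ^+ k)%:E)%E.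
Proof.
move=> n2 k0 e0 b0 bk mF FR.
pose h t := margin_loss Psi (F t).
have bh := bm_joint_margin_loss mF.
pose l := n%:R * e / (32 * M ^+ 2); pose delta := e / 8.
have n0 : 0 < n%:R :> R by rewrite ltr0n ltnW.
have kr : 0 < k%:R :> R by rewrite ltr0n.
have d0 : 0 < delta by rewrite divr_gt0.
have l0 : 0 <= l by rewrite divr_ge0 ?mulr_ge0// ltW// exprn_gt0.
pose N := (2 * ((4 * n ^ 2 + 1) ^ V)%:R : R) ^+ k.
pose err := delta + L ^+ 2 * b ^+ 2 / (4 * delta * k%:R).
pose K := expR (2 * l * err) * N * expR (8 * M ^+ 2 * l ^+ 2 / n%:R).
have sym : \int[P]_w expR (l * (\int[(mu \x mu)%E]_z h (sample n w) z -
    ustat (h (sample n w)) (sample n w))) <= K.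
  apply: (symmetrization D_iid n2 bh) => z s0.
  rewrite (_ : (fun s => _) = (fun s => expR (l * swap_deviation
    (fun p => h (pick_tuple z s) (z p.1, z p.2)) s))); last first.
    by apply/funext => s; rewrite swap_deviation_ustat.
  have t1 (p : ('I_n * bool) * ('I_n * bool)) :
      `|- Num.sg (half_diff (z p.1) (z p.2))| <= 1.
    by rewrite normrN normr_sg lern1 leq_b1.
  apply: (le_trans (pattern_class_mgf Psi_lip Psi_bnd t1 b0 s0 n2 k0 d0 l0
    (fun s => combination_pattern_kernel z (FR (pick_tuple z s))))).
  rewrite ler_wpM2r ?expR_ge0// ler_wpM2l ?expR_ge0// lerXn2r ?nnegrE ?mulr_ge0//.
  rewrite ler_wpM2l// ler_nat (leq_trans (card_patterns _ Rs_VC))//.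
  rewrite !card_prod card_ord card_bool (_ : _ * _ = 4 * n ^ 2)%N//.
  by rewrite expnS expn1 mulnACA mulnC.
have tail := expR_tail e (bmB (bm_mean_sample mu D bh) (bm_ustat_sample D bh)) l0 sym.
apply: (le_trans tail).
rewrite lee_fin /K.
rewrite (_ : _ * _ = expR (- (l * e) + 2 * l * err + 8 * M ^+ 2 * l ^+ 2 / n%:R) * N); last first.
  by rewrite !expRD; ring.
rewrite ler_wpM2r ?exprn_ge0 ?mulr_ge0// ler_expR.
have err2 : err <= e / 4.
  rewrite /err /delta (_ : L ^+ 2 * b ^+ 2 / (4 * (e / 8) * k%:R) =
    16 * L ^+ 2 * b ^+ 2 / (8 * e * k%:R)); last by field; rewrite !gt_eqF.
  have : 16 * L ^+ 2 * b ^+ 2 / (8 * e * k%:R) <= e / 8.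
    rewrite ler_pdivrMr ?mulr_gt0//.
    by rewrite (_ : e / 8 * _ = e ^+ 2 * k%:R)//; field.
  lra.
rewrite (_ : - (n%:R * (e ^+ 2 / (128 * M ^+ 2))) =
   - (l * e) + 2 * l * (e / 4) + 8 * M ^+ 2 * l ^+ 2 / n%:R); last first.
  by rewrite /l; field; rewrite !gt_eqF.
by rewrite lerD2r lerD2l ler_wpM2l// mulr_ge0.
Qed.

End Margins.

(** * Summability *)

(** Comparison with the geometric series of ratio [exp (- c)], once the finitely many events without
    a bound are replaced by the empty set. *)
Lemma borel_cantelli_expR (R : realType) d (Omega : measurableType d)
    (P : probability Omega R) (E : nat -> set Omega) (c : R) :
  0 < c -> (forall n, measurable (E n)) ->
  (\forall n \near \oo, (P (E n) <= (expR (- (n%:R * c)))%:E)%E) ->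
  {ae P, forall w, \forall n \near \oo, ~ E n w}.
Proof.
move=> c0 mE [N _ tail].
pose F n := if (n < N)%N then set0 else E n.
have mF n : measurable (F n) by rewrite /F; case: ifP.
pose q := expR (- c).
have q0 : 0 < q by exact: expR_gt0.
have q1 : 0 < 1 - q by rewrite subr_gt0 /q -expR0 ltr_expR oppr_lt0.
have Fq n : (P (F n) <= (q ^+ n)%:E)%E.
  rewrite /F; case: ltnP => nN; first by rewrite measure0 lee_fin exprn_ge0// ltW.
  apply: (le_trans (tail n nN)); rewrite lee_fin /q -expRM_natl.
  by rewrite mulrN.
have sumF : (\sum_(n <oo) P (F n) < +oo)%E.
  apply: (@le_lt_trans _ _ ((1 - q)^-1)%:E); last exact: ltry.
  apply: lime_le; first exact: is_cvg_nneseries.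
  apply: nearW => n; apply: (@le_trans _ _ (\sum_(0 <= i < n) (q ^+ i)%:E)%E).
    exact: lee_sum.
  rewrite sumEFin lee_fin big_mkord.
  rewrite -(ler_pM2l q1) mulfV ?gt_eqF// -opprB mulNr -subrX1 opprB.
  by rewrite lerBlDr lerDl exprn_ge0// ltW.
exists (lim_sup_set F); split.
- by apply: bigcap_measurable => // k _; exact: bigcup_measurable.
- exact: lim_sup_set_cvg0.
- move=> w /= nw k _; apply: contrapT => H; apply: nw.
  exists (maxn N k) => // n /=; rewrite geq_max => /andP[Nn kn] Ew.
  by apply: H; exists n => //=; rewrite /F ltnNge Nn.
Qed.

Lemma root4 (R : realType) (n : nat) : Num.sqrt (Num.sqrt (n%:R : R)) ^+ 4 = n%:R.
Proof. by rewrite (exprM _ 2 2) !sqr_sqrtr// sqrtr_ge0. Qed.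

(** With [w] the fourth root of [n], [k] is of order [w^2] and its base at most
    [exp (13 (V + 1) w)]; the resulting [A w^3] is eventually below half of
    [kappa w^4 = kappa n]. *)
Lemma class_tail_summable (R : realType) (V : nat) (C kappa : R) (b : nat -> R) :
  0 <= C -> 0 < kappa -> (\forall n \near \oo, b n ^+ 2 <= Num.sqrt n%:R) ->
  \forall n \near \oo, exists2 k, (0 < k)%N & C * b n ^+ 2 <= k%:R /\
    expR (- (n%:R * kappa)) * (2 * ((4 * n ^ 2 + 1) ^ V)%:R) ^+ k <=
    expR (- (n%:R * (kappa / 2))).
Proof.
move=> C0 kappa0 bn.
pose A : R := 13 * (V.+1)%:R * (C + 1).
have A0 : 0 <= A by rewrite !mulr_ge0// addr_ge0.
near=> n.
set w := Num.sqrt (Num.sqrt (n%:R : R)).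
have w4 : w ^+ 4 = n%:R by exact: root4.
have w2 : w ^+ 2 = Num.sqrt n%:R by rewrite sqr_sqrtr ?sqrtr_ge0.
have w0 : 0 <= w by exact: sqrtr_ge0.
have kA : 0 <= 2 * A / kappa by apply: divr_ge0; [exact: mulr_ge0|exact: ltW].
have wbig : 1 + 2 * A / kappa <= w.
  have D0 : 0 <= 1 + 2 * A / kappa by rewrite addr_ge0.
  rewrite -(@ler_pXn2r _ 4) ?nnegrE// w4; near: n; exact: nbhs_infty_ger.
have wA : 2 * A / kappa <= w by apply: le_trans wbig; rewrite lerDr.
have w1 : 1 <= w.
  by apply: le_trans wbig; rewrite lerDl.
exists (Num.truncn (C * w ^+ 2)).+1 => //.
have /andP[tlo thi] := truncn_itv (mulr_ge0 C0 (sqr_ge0 w)).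
split.
  apply: ltW; apply: le_lt_trans thi; apply: ler_wpM2l => //.
  by rewrite w2; near: n.
set k := (Num.truncn _).+1.
have kw : k%:R <= (C + 1) * w ^+ 2.
  rewrite /k -natr1; have : 1 <= w ^+ 2 by rewrite exprn_ege1.
  lra.
have wexp : w <= expR w.
  by apply: le_trans (expR_ge1Dx w); rewrite lerDr.
have n5 : (2 * ((4 * n ^ 2 + 1) ^ V)%:R : R) <= expR (13 * (V.+1)%:R * w).
  (* 13 = 5 + 8, from [5 <= exp (5 w)] and [n^2 = w^8 <= exp (8 w)]. One further factor [5 n^2] will
     absorb the leading 2, whence [V.+1]. *)
  have base : (5 * n ^ 2)%:R <= expR (13 * w).
    rewrite natrM natrX -w4 -exprM.
    have -> : 13 * w = 5 * w + 8 * w by ring.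
    rewrite expRD ler_pM//; first exact: exprn_ge0.
      apply: le_trans (expR_ge1Dx _); lra.
    by rewrite expRM_natl lerXn2r ?nnegrE ?expR_ge0.
  have n2 : (2 <= n)%N by near: n; exact: nbhs_infty_ge.
  apply: (@le_trans _ _ ((5 * n ^ 2) ^ V.+1)%:R).
    rewrite -natrM ler_nat (expnS (5 * n ^ 2)) leq_mul//.
      by rewrite (leq_trans _ (leq_pmulr _ _))// expn_gt0 (ltnW n2).
    have le5 : (4 * n ^ 2 + 1 <= 5 * n ^ 2)%N.
      by rewrite (mulSn 4) addnC leq_add2r expn_gt0 (ltnW n2).
    by case: (V) => // V'; rewrite leq_exp2r.
  rewrite natrX (mulrC 13) -mulrA expRM_natl.
  by rewrite lerXn2r ?nnegrE ?expR_ge0.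
apply: (@le_trans _ _ (expR (- (n%:R * kappa)) * expR (13 * (V.+1)%:R * w) ^+ k)).
  rewrite ler_wpM2l ?expR_ge0// lerXn2r ?nnegrE ?expR_ge0//.
rewrite -expRM_natl -expRD ler_expR -w4.
have k13 : k%:R * (13 * (V.+1)%:R * w) <= A * w ^+ 3.
  rewrite (_ : A * w ^+ 3 = (C + 1) * w ^+ 2 * (13 * (V.+1)%:R * w)).
    by rewrite ler_wpM2r// !mulr_ge0.
  by rewrite /A; ring.
have : A * w ^+ 3 <= kappa / 2 * w ^+ 4.
  rewrite (exprS w 3) [leRHS]mulrA ler_wpM2r ?exprn_ge0//.
  by move: wA; rewrite ler_pdivrMr//; lra.
by move=> ?; lra.
Unshelve. all: by end_near. Qed.

(** * Calibration *)

(** The sum counts the [k] with [k + 1 <= N x], so it is the integer part of [N x]: a layer-cake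
    approximation that passes from indicators to bounded nonnegative functions. *)
Lemma level_set_sum (R : realType) (x : R) (N K : nat) : 0 <= x -> x <= K%:R ->
  (0 < N)%N ->
  `|x - N%:R^-1 * \sum_(k < K * N) \1_[set y : R | k.+1%:R <= N%:R * y] x| <= N%:R^-1.
Proof.
move=> x0 xK N0; have Nr : 0 < N%:R :> R by rewrite ltr0n.
have Nx0 : 0 <= N%:R * x by rewrite mulr_ge0// ltW.
set m := Num.truncn (N%:R * x).
have mK : (m <= K * N)%N.
  rewrite -(ler_nat R); have /andP[lo _] := truncn_itv Nx0.
  by rewrite (le_trans lo)// natrM mulrC ler_wpM2r// ltW.
have -> : \sum_(k < K * N) \1_[set y : R | k.+1%:R <= N%:R * y] x = m%:R :> R.
  under eq_bigr => k _.
    rewrite indicE (_ : (x \in _) = (k < m)%N); last first.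
      by rewrite /m truncn_gt_nat; apply/idP/idP; rewrite inE.
    over.
  rewrite -natr_sum -(big_mkord predT (fun k => nat_of_bool (k < m)%N)).
  rewrite (big_cat_nat (n := m))//= [X in (_ + X)%N]big1_seq ?addn0; last first.
    by move=> k; rewrite mem_index_iota => /andP[_ /andP[mk _]]; rewrite ltnNge mk.
  rewrite (eq_big_nat _ _ (F2 := fun=> 1%N)); last by move=> k /andP[_ ->].
  by rewrite sum_nat_const_nat subn0 muln1.
have /andP[lo hi] := truncn_itv Nx0; rewrite -/m -natr1 in lo hi.
rewrite -(ler_pM2l Nr) -{1}(gtr0_norm Nr) -normrM mulrBr mulrA.
by rewrite mulfV ?gt_eqF// mul1r ler_norml; apply/andP; split; lra.
Qed.

Definition set_sign (R : realType) (T : Type) (C : set T) (y : T) : R :=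
  if y \in C then 1 else -1.

Lemma bm_set_sign (R : realType) d (T : measurableType d) (C : set T) :
  measurable C -> bounded_measurable (set_sign R C).
Proof.
move=> mC; rewrite (_ : set_sign R C = fun y => 2 * \1_C y - 1).
  by apply: bmB; [apply: bmZ; exact: bm_indic|exact: bm_cst].
by apply/funext => y; rewrite /set_sign indicE; case: ifP => _ /=; lra.
Qed.

(* The Hahn decomposition of the image of the signed measure of density s gives
   the Bayes rule. *)
Lemma optimal_sign (R : realType) d1 d2 (T1 : measurableType d1)
    (T2 : measurableType d2) (Q : probability T1 R) (inst : T1 -> T2) (s : T1 -> R) :
  measurable_fun setT inst -> bounded_measurable s ->
  exists2 C : set T2, measurable C & forall h : T2 -> R, bounded_measurable h ->
    (forall y, 0 <= h y) -> 0 <= \int[Q]_z (s z * set_sign R C (inst z) * h (inst z)).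
Proof.
move=> minst bs.
have mpre A : measurable A -> measurable (inst @^-1` A).
  by move=> mA; rewrite -[X in measurable X]setTI; apply: minst.
pose nu0 := induced_charge (bm_integrable Q bs).
pose nu : {charge set T2 -> \bar R} :=
  measure_function_pushforward__canonical__charge_Charge nu0 minst.
have [C [N [[mC posC] [mN negN] CN CN0]]] := Hahn_decomposition nu.
have bI A : measurable A -> bounded_measurable (fun z => \1_A (inst z) : R).
  by move=> mA; exact: (bm_comp (bm_indic mA) minst).
have nuE A : measurable A -> nu A = (\int[Q]_z (s z * \1_A (inst z)))%:E.
  move=> mA; rewrite -EFin_mean; last by apply: bmM => //; exact: bI.
  transitivity (\int[Q]_(z in inst @^-1` A) (s z)%:E)%E; first by [].
  rewrite integral_mkcond; apply: eq_integral => z _.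
  rewrite patchE indicE.
  have -> : (z \in inst @^-1` A) = (inst z \in A) by apply/idP/idP; rewrite !inE.
  by case: ifP => _ /=; rewrite ?mulr1 ?mulr0.
exists C => // h bh h0.
have bsig := bm_comp (bm_set_sign R mC) minst.
have bss : bounded_measurable (fun z => s z * set_sign R C (inst z)) by exact: bmM.
(* The sign is 1 on [C] and -1 on the complement [N], so the positive part of the charge is added
   and the negative part subtracted. *)
have ind A : measurable A ->
    0 <= \int[Q]_z (s z * set_sign R C (inst z) * \1_A (inst z)).
  move=> mA.
  have -> : (fun z => s z * set_sign R C (inst z) * \1_A (inst z)) =
      (fun z => s z * \1_(A `&` C) (inst z) - s z * \1_(A `&` N) (inst z)).
    apply/funext => z; rewrite !indicE !in_setI /set_sign.
    have -> : (inst z \in N) = ~~ (inst z \in C).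
      have : (C `|` N) (inst z) by rewrite CN.
      have : ~ (C `&` N) (inst z) by rewrite CN0.
      move=> nCN CUN; apply/idP/negP; rewrite !inE; first by move=> ? ?; apply: nCN.
      by case: CUN.
    case: (inst z \in A); case: (inst z \in C); rewrite /= ?mulr1 ?mulr0 ?subr0 ?sub0r//.
    by rewrite mulrN1.
  have mAC := measurableI _ _ mA mC; have mAN := measurableI _ _ mA mN.
  rewrite meanB; [|by apply: bmM => //; exact: bI..].
  rewrite subr_ge0; apply: (@le_trans _ _ 0).
    by rewrite -lee_fin -nuE//; apply: negN => // y [].
  by rewrite -lee_fin -nuE//; apply: posC => // y [].
have [M hM] := bh.2; have [S sS] := bss.2.
pose K := (Num.truncn M).+1.
have hK y : h y <= K%:R.
  have := hM y; rewrite ger0_norm// => /le_trans; apply.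
  have M0 : 0 <= M := le_trans (normr_ge0 _) (hM y).
  by have /andP[_ /ltW] := truncn_itv M0.
have bsh : bounded_measurable (fun z => s z * set_sign R C (inst z) * h (inst z)).
  by apply: bmM => //; exact: bm_comp.
apply/ler_addgt0Pr => e e0.
pose n := (Num.truncn (`|S| / e)).+1.
have nr : 0 < n%:R :> R by rewrite ltr0n.
have Sn : `|S| * n%:R^-1 <= e.
  have /andP[_ /ltW] := truncn_itv (divr_ge0 (normr_ge0 S) (ltW e0)).
  by rewrite -/n ler_pdivrMr// ler_pdivrMr// mulrC.
pose lev (k : nat) := h @^-1` [set y : R | k.+1%:R <= n%:R * y].
have mlev k : measurable (lev k).
  have -> : lev k = h @^-1` `[k.+1%:R / n%:R, +oo[.
    by apply/seteqP; split=> y /=; rewrite in_itv/= andbT ler_pdivrMr// mulrC.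
  by rewrite -[X in measurable X]setTI; exact: bh.1.
pose hn y := n%:R^-1 * \sum_(k < K * n) \1_(lev k) y : R.
have hnE y : `|h y - hn y| <= n%:R^-1 by exact: level_set_sum.
have bhn : bounded_measurable hn by apply: bmZ; apply: bm_sum => k; exact: bm_indic.
have bshn : bounded_measurable (fun z => s z * set_sign R C (inst z) * hn (inst z)).
  by apply: bmM => //; exact: bm_comp.
have int_hn : 0 <= \int[Q]_z (s z * set_sign R C (inst z) * hn (inst z)).
  have -> : (fun z => s z * set_sign R C (inst z) * hn (inst z)) = (fun z => n%:R^-1 *
      \sum_(k < K * n) (s z * set_sign R C (inst z) * \1_(lev k) (inst z))).
    by apply/funext => z; rewrite /hn mulrCA mulr_sumr.
  have bk (k : 'I_(K * n)) : bounded_measurable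
      (fun z => s z * set_sign R C (inst z) * \1_(lev k) (inst z)).
    by apply: bmM => //; exact: bI.
  rewrite meanZ ?mean_sum//; last exact: bm_sum.
  by rewrite mulr_ge0 ?invr_ge0 ?sumr_ge0// => k _; exact: ind.
rewrite (le_trans int_hn)// -(mean_cst Q e) -meanD//; last exact: bm_cst.
apply: mean_le => //; first by apply: bmD => //; exact: bm_cst.
move=> z; rewrite -lerBlDl -mulrBr (le_trans (ler_norm _))// normrM distrC.
apply: le_trans Sn; apply: ler_pM => //.
exact: le_trans (sS z) (ler_norm S).
Qed.

Section Calibration.
Context {d : measure_display} {X : measurableType d} {R : realType}.
Local Notation Z := (X * R)%type.
Context (mu : probability Z R) (phi : R -> R).
Context (phi_ge0 : forall x, 0 <= phi x) (phi_cvx : convexR phi)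
  (phi0 : phi 0 = 1) (dphi : derivable phi 0 1) (c_gt0 : 0 < derive1 phi 0).

Local Notation c := (derive1 phi 0).
Local Notation Q := (mu \x mu)%E.
Local Notation s := (fun p : Z * Z => Num.sg (half_diff p.1 p.2)).

(** [phi] may be unbounded, but on the range of the margins of [q] it agrees with its truncation at
    [|B| + 1]. *)
Lemma bm_margin_loss (q : X * X -> R) : bounded_measurable q -> bounded_measurable (margin_loss phi q).
Proof.
move=> [mq [B qB]]; pose T := `|B| + 1.
have T0 : 0 < T by rewrite ltr_wpDl.
have E : margin_loss phi q = margin_loss (fun x => phi (trunc T x)) q.
  apply/funext => p; rewrite /margin_loss trunc_id// -ler_norml normrM normrN.
  have := qB (instances p); have := ler_norm B.
  have : `|Num.sg (half_diff p.1 p.2)| <= 1 by rewrite normr_sg lern1 leq_b1.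
  have := normr_ge0 (q (instances p)).
  have := normr_ge0 (Num.sg (half_diff p.1 p.2)).
  by rewrite /T; nra.
rewrite E; split.
  by apply: measurable_margin_loss => //; exact: measurable_truncated_cost.
exists (phi T + phi (- T)) => p.
by rewrite ger0_norm ?phi_ge0//; exact: truncated_cost_le.
Qed.

Lemma cost_mean (q : X * X -> R) : bounded_measurable q ->
  cost mu phi q = (\int[Q]_p margin_loss phi q p)%:E.
Proof. by move=> bq; rewrite -EFin_mean//; exact: bm_margin_loss. Qed.

Lemma bm_rule (r : X * X -> R) : ranking_rule r -> bounded_measurable r.
Proof.
move=> [mr r1]; split => //; exists 1 => q.
by have [->|->] := r1 q; rewrite ?normrN normr1.
Qed.

Lemma ranking_rule_induced (q : X * X -> R) : measurable_fun setT q ->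
  ranking_rule (induced_rule q).
Proof.
move=> mq; split; last first.
  by move=> x; rewrite /induced_rule; case: ifP; [left|right].
apply: measurable_fun_ifT => //.
apply: (measurable_fun_bool true); rewrite setTI.
rewrite (_ : _ @^-1` _ = q @^-1` `]0, +oo[); last first.
  by apply/seteqP; split=> x /=; rewrite in_itv/= andbT.
by rewrite -[X in measurable X]setTI; exact: mq.
Qed.

(** For [r] of values 1 and -1, the indicator of [s * r < 0] is [(|s| - s * r) / 2], also at ties
    [s = 0]; the risk becomes affine in the rule. *)
Lemma risk_mean (r : X * X -> R) : ranking_rule r ->
  risk mu r = (2^-1 * (\int[Q]_p `|s p| - \int[Q]_p (s p * r (instances p))))%:E.
Proof.
move=> rr; have br := bm_rule rr.
have bs := @bm_sgr_half_diff _ X R.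
have bri := bm_comp br (@measurable_instances _ X R).
have babs : bounded_measurable (fun p : Z * Z => `|s p|).
  by split; [exact: measurableT_comp bs.1|have [M H] := bs.2; exists M => p; rewrite normr_id].
have E : [set p | half_diff p.1 p.2 * r (p.1.1, p.2.1) < 0] =
    [set p : Z * Z | s p * r (instances p) < 0].
  apply/seteqP; split=> p /=; rewrite /instances;
    by have [->|->] := rr.2 (p.1.1, p.2.1);
    rewrite ?mulr1 ?mulrN1 ?oppr_lt0 ?sgr_lt0 ?sgr_gt0.
have mA : measurable [set p : Z * Z | s p * r (instances p) < 0].
  rewrite (_ : [set p | _] = (fun p => s p * r (instances p)) @^-1` `]-oo, 0[).
    by have [m _] := bmM bs bri; rewrite -[X in measurable X]setTI; exact: m.
  by apply/seteqP; split=> p /=; rewrite in_itv.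
rewrite /risk E -[LHS](mean_indic Q mA) -meanB//; last exact: bmM.
rewrite -meanZ; last by apply: bmB => //; exact: bmM.
congr (_%:E); apply: eq_Rintegral => p _; rewrite indicE.
have -> : (p \in [set p : Z * Z | s p * r (instances p) < 0]) = (s p * r (instances p) < 0).
  by apply/idP/idP; rewrite inE.
case: (rr.2 (instances p)) => ->; rewrite ?mulr1 ?mulrN1 ?oppr_lt0 ?sgr_lt0 ?sgr_gt0;
  case: (ltgtP (half_diff p.1 p.2) 0) => H;
  rewrite ?(ltr0_sg H) ?(gtr0_sg H) ?H ?sgr0 ?normrN ?normr0 ?normr1 /=; lra.
Qed.

(** On the set [W] where the induced rule differs from the Bayes rule [rs], the tangent at 0 bounds
    the loss below by [1 + c * s * rs * |q|], whose last term has nonnegative mean over [W] by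
    optimality of [rs]. Using [a * rs] there instead costs about [1 - a * c * s * rs]. So the excess
    cost is at least [a * c] times the excess risk [Delta], up to the first-order remainder. *)
Lemma calibration eta : 0 < eta -> exists2 delta, 0 < delta &
  forall q : X * X -> R, bounded_measurable q ->
    (cost mu phi q <= optimal_cost mu phi + delta%:E)%E ->
    (risk mu (induced_rule q) <= optimal_risk mu + eta%:E)%E.
Proof.
move=> eta0.
have bs := @bm_sgr_half_diff _ X R.
have [C mC optC] := optimal_sign Q (@measurable_instances _ X R) bs.
pose rs := set_sign R C : X * X -> R.
have rsr : ranking_rule rs.
  split; first exact: (bm_set_sign R mC).1.
  by move=> y; rewrite /rs /set_sign; case: ifP; [left|right].
have brs := bm_rule rsr.
have bsrs : bounded_measurable (fun p => s p * rs (instances p)).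
  by apply: bmM => //; exact: (bm_comp brs (@measurable_instances _ X R)).
(* A rule is [rs] with its sign reversed on [W], so its excess risk is the integral of [s * rs] over
   [W]. *)
have gap (r : X * X -> R) : ranking_rule r -> exists W : set (X * X),
    [/\ measurable W, forall y, (y \in W) = (r y != rs y) &
        risk mu r = (risk mu rs +
          (\int[Q]_p (s p * rs (instances p) * \1_W (instances p)))%:E)%E].
  move=> rr; have br := bm_rule rr; pose W := [set y | r y != rs y].
  have mW : measurable W.
    rewrite (_ : W = ~` ((fun y => r y - rs y) @^-1` [set 0])); last first.
      apply/seteqP; split=> y /=; first by move=> /eqP + /eqP; rewrite subr_eq0 => + /eqP.
      by move=> H; apply/negP => /eqP E; apply: H; rewrite E subrr.
    apply: measurableC; rewrite -[X in measurable X]setTI.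
    by have [m _] := bmB br brs; exact: m.
  have Win y : (y \in W) = (r y != rs y) by apply/idP/idP; rewrite inE.
  exists W; split => //.
  rewrite !risk_mean// -EFinD; congr (_%:E).
  have bW : bounded_measurable (fun p : Z * Z => \1_W (instances p) : R).
    exact: (bm_comp (bm_indic mW) (@measurable_instances _ X R)).
  have -> : (fun p : Z * Z => s p * r (instances p)) = (fun p => s p * rs (instances p) -
      2 * (s p * rs (instances p) * \1_W (instances p))).
    apply/funext => p; rewrite indicE Win; set y := instances p.
    have n1 : (1 == -1 :> R) = false by rewrite gt_eqF// ltrN10.
    have n2 : (-1 == 1 :> R) = false by rewrite lt_eqF// ltrN10.
    by have [->|->] := rr.2 y; have [->|->] := rsr.2 y; rewrite ?eqxx ?n1 ?n2 /=; lra.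
  rewrite meanB//; last by apply: bmZ; exact: bmM.
  rewrite meanZ; last exact: bmM.
  by field.
have opt_rs : (risk mu rs <= optimal_risk mu)%E.
  apply: le_ereal_inf_tmp => _ [r rr <-].
  have [W [mW _ ->]] := gap r rr; rewrite leeDl// lee_fin.
  by apply: optC; [exact: bm_indic|move=> y; rewrite indicE].
(* Half of [a * c * eta] is spent on the first-order remainder and half on the allowed excess
   cost. *)
have e0 : 0 < c * eta / 2 by rewrite divr_gt0// mulr_gt0.
have [a a0 [phia phina]] := derive_small_step phi0 dphi e0.
have da : 0 < a * c * eta / 2 by rewrite divr_gt0// !mulr_gt0.
exists (a * c * eta / 2) => // q bq costq.
have [W [mW WE ->]] := gap _ (ranking_rule_induced bq.1).
set Delta := \int[Q]_p _.
apply: leeD => //; rewrite lee_fin.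
pose q' y := \1_W y * (a * rs y) + (1 - \1_W y) * q y.
have bW := bm_indic mW : bounded_measurable (fun y => \1_W y : R).
have bq' : bounded_measurable q'.
  apply: bmD; first by apply: bmM => //; exact: bmZ.
  by apply: bmM => //; apply: bmB => //; exact: bm_cst.
have le1 : \int[Q]_p margin_loss phi q p <=
    \int[Q]_p margin_loss phi q' p + a * c * eta / 2.
  rewrite -lee_fin EFinD -!cost_mean//; apply: (le_trans costq).
  by rewrite leeD2r//; apply: ereal_inf_lbound; exists q' => //; exact: bq'.1.
pose absq y := `|q y| * \1_W y.
have babsq : bounded_measurable absq.
  apply: bmM => //; split; first exact: measurableT_comp bq.1.
  by have [M H] := bq.2; exists M => y; rewrite normr_id.
have pt p : c * (s p * rs (instances p) * absq (instances p)) +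
    a * c * (s p * rs (instances p) * \1_W (instances p)) - c * eta / 2 * a <=
    margin_loss phi q p - margin_loss phi q' p.
  rewrite /margin_loss /absq /q' !indicE WE; set y := instances p.
  have tangent := convex_tangent phi_cvx phi0 dphi.
  have rem0 : 0 <= c * eta / 2 * a by rewrite mulr_ge0// ltW.
  have n1 : (1 == -1 :> R) = false by rewrite gt_eqF// ltrN10.
  have n2 : (-1 == 1 :> R) = false by rewrite lt_eqF// ltrN10.
  rewrite /induced_rule; case: ltP => qy; have [rsy|rsy] := rsr.2 y;
    rewrite rsy ?eqxx ?n1 ?n2 /= ?mulr0 ?mulr1 ?mul0r ?mul1r ?subrr ?subr0 ?add0r ?mul0r ?addr0 ?mul1r ?subrr;
    try lra.
  - rewrite (gtr0_norm qy).
    have := tangent (- Num.sg (half_diff p.1 p.2) * q y).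
    case: (ltgtP (half_diff p.1 p.2) 0) => H;
      rewrite ?(ltr0_sg H) ?(gtr0_sg H) ?H ?sgr0 ?oppr0 ?opprK ?mul0r ?mul1r ?mulrN ?mulN1r ?mulr1 ?opprK ?phi0; lra.
  - rewrite (ler0_norm qy).
    have := tangent (- Num.sg (half_diff p.1 p.2) * q y).
    case: (ltgtP (half_diff p.1 p.2) 0) => H;
      rewrite ?(ltr0_sg H) ?(gtr0_sg H) ?H ?sgr0 ?oppr0 ?opprK ?mul0r ?mul1r ?mulrN ?mulN1r ?mulr1 ?opprK ?phi0; lra.
have b1 : bounded_measurable (fun p => s p * rs (instances p) * absq (instances p)).
  by apply: bmM => //; exact: (bm_comp babsq (@measurable_instances _ X R)).
have b2 : bounded_measurable (fun p => s p * rs (instances p) * \1_W (instances p)).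
  by apply: bmM => //; exact: (bm_comp bW (@measurable_instances _ X R)).
have pos : 0 <= \int[Q]_p (s p * rs (instances p) * absq (instances p)).
  by apply: optC => // y; rewrite mulr_ge0// indicE.
have bl := bm_margin_loss bq; have bl' := bm_margin_loss bq'.
have b3 : bounded_measurable (fun p => c * (s p * rs (instances p) * absq (instances p)) +
    a * c * (s p * rs (instances p) * \1_W (instances p))).
  by apply: bmD; exact: bmZ.
have := mean_le Q (bmB b3 (bm_cst _ (c * eta / 2 * a))) (bmB bl bl') pt.
rewrite !meanB//; last exact: bm_cst.
rewrite mean_cst meanD ?meanZ//; [|exact: bmZ..]; rewrite -/Delta => le2.
have cpos := mulr_ge0 (ltW c_gt0) pos.
have : a * c * Delta <= a * c * eta by lra.
by rewrite ler_pM2l// mulr_gt0.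
Qed.

End Calibration.

(** * Consistency *)

Section Combinations.
Context {d : measure_display} {X : measurableType d} {R : realType}.
Context (Rs : set (X * X -> R)).

(* Add two opposite multiples of one of the rules. *)
Lemma combinations_le (b b' : R) q : 0 < b -> b <= b' ->
  combinations Rs b q -> combinations Rs b' q.
Proof.
move=> b0 bb' [N [w [g [wb gR ->]]]].
case: N w g wb gR => [|N] w g wb gR; first by move: b0; rewrite -wb big_ord0 ltxx.
pose c := (b' - b) / 2.
have c0 : 0 <= c by rewrite divr_ge0// subr_ge0.
pose w' (i : 'I_(2 + N.+1)) := match fintype.split i with
  | inl i => if i == ord0 then c else - c | inr j => w j end.
pose g' (i : 'I_(2 + N.+1)) := match fintype.split i with
  | inl _ => g ord0 | inr j => g j end.
have sl i : fintype.split (lshift N.+1 i) = inl i := unsplitK (inl i).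
have sr j : fintype.split (rshift 2 j) = inr j := unsplitK (inr j).
exists (2 + N.+1)%N, w', g'; split.
- rewrite big_split_ord/=; under [X in _ + X]eq_bigr do rewrite /w' sr.
  rewrite wb !big_ord_recl big_ord0 /w' !sl /=.
 rewrite normrN ger0_norm// /c.
  by rewrite addr0; field.
- by move=> i; rewrite /g'; case: fintype.split.
- apply/funext => x; rewrite big_split_ord/=.
  rewrite [X in _ = _ + X](eq_bigr (fun j => w j * g j x)); last first.
    by move=> j _; rewrite /w' /g' sr.
  rewrite !big_ord_recl big_ord0 /w' /g' !sl /=.
  by rewrite mulNr addr0 subrr add0r.
Qed.

Lemma combinations_bm (b : R) q : (forall r, Rs r -> ranking_rule r) ->
  combinations Rs b q -> bounded_measurable q.
Proof.
move=> rules [N [w [g [_ gR ->]]]]; apply: bm_sum => j.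
by apply: bmZ; apply: bm_rule; exact: rules.
Qed.

Lemma empirical_cost_ge0 (phi : R -> R) n (s : n.-tuple (X * R)) q :
  (forall x, 0 <= phi x) -> 0 <= empirical_cost phi s q.
Proof.
move=> phi_ge0; rewrite mulr_ge0 ?ustat_weight_ge0// sumr_ge0// => i _.
exact: sumr_ge0.
Qed.

Lemma empirical_minimizer_le (phi : R -> R) n (s : n.-tuple (X * R)) F q q' :
  (forall x, 0 <= phi x) -> empirical_minimizer phi s F q -> F q' ->
  empirical_cost phi s q <= empirical_cost phi s q' + n%:R^-1.
Proof.
move=> phi_ge0 [[_ min] Fq'|[_ _ le] Fq']; first by rewrite ler_wpDr// min.
apply: (le_trans le); rewrite lerD2r; apply: inf_lbound; last by exists q'.
by exists 0 => _ [x _ <-]; exact: empirical_cost_ge0.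
Qed.

Lemma empirical_minimizer_in (phi : R -> R) n (s : n.-tuple (X * R)) F q :
  empirical_minimizer phi s F q -> F q.
Proof. by move=> [[]|[]]. Qed.

Context (mu : probability (X * R)%type R).

Lemma optimal_cost_fin (phi : R -> R) : (forall x, 0 <= phi x) -> phi 0 = 1 ->
  optimal_cost mu phi \is a fin_num.
Proof.
move=> phi_ge0 phi0; apply/fin_numP; split.
  rewrite gt_eqF// (@lt_le_trans _ _ 0%E)//.
  by apply: le_ereal_inf_tmp => _ [q _ <-]; apply: integral_ge0 => p _; rewrite lee_fin.
rewrite lt_eqF// (@le_lt_trans _ _ 1%E) ?ltry//.
apply: ereal_inf_lbound; exists (fun=> 0) => /=; first exact: measurable_cst.
rewrite /cost; under eq_integral do rewrite mulr0 phi0.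
by rewrite integral_cst// mul1e; exact: probability_setT.
Qed.

Lemma optimal_risk_fin : optimal_risk mu \is a fin_num.
Proof.
apply/fin_numP; split.
  rewrite gt_eqF// (@lt_le_trans _ _ 0%E)//.
  by apply: le_ereal_inf_tmp => _ [r _ <-]; exact: measure_ge0.
have r1 : ranking_rule (fun _ : X * X => 1 : R) by split; [exact: measurable_cst|left].
rewrite lt_eqF// (@le_lt_trans _ _ (risk mu (fun=> 1)))//.
  by apply: ereal_inf_lbound; exists (fun=> 1).
by rewrite risk_mean// ltry.
Qed.

End Combinations.

(** [trunc] is odd and fixes 0, so it commutes with multiplication by a sign. The truncated loss of
    [q] is thus the original loss of a bounded function, to which calibration applies. *)
Lemma margin_loss_trunc (R : realType) d (X : measurableType d) (phi : R -> R) T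
    (q : X * X -> R) : 0 <= T ->
  margin_loss (fun x => phi (trunc T x)) q = margin_loss phi (fun y => trunc T (q y)).
Proof.
move=> T0; apply/funext => p; rewrite /margin_loss; congr phi.
have t0 : trunc T 0 = 0 by rewrite trunc_id// oppr_le0 T0.
case: (ltgtP (half_diff p.1 p.2) 0) => H;
  rewrite ?(ltr0_sg H) ?(gtr0_sg H) ?H ?sgr0 ?oppr0 ?opprK ?mul0r ?mul1r ?mulN1r//.
exact: truncN.
Qed.

Lemma induced_rule_trunc (R : realType) d (X : measurableType d) (T : R)
    (q : X * X -> R) : 0 < T ->
  induced_rule (fun y => trunc T (q y)) = induced_rule q.
Proof. by move=> T0; apply/funext => y; rewrite /induced_rule trunc_gt0. Qed.

Lemma rate_sqrt (R : realType) (phi : R -> R) (B : nat -> R) :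
  convexR phi -> phi 0 = 1 -> derivable phi 0 1 -> 0 < derive1 phi 0 ->
  (forall n, 0 < B n) ->
  (B n) ^+ 2 * right_derivative phi (B n) / Num.sqrt n%:R @[n --> \oo] --> (0 : R) ->
  \forall n \near \oo, B n ^+ 2 <= Num.sqrt n%:R.
Proof.
move=> cphi phi0 dphi c0 B0 /cvgrPdist_lt/(_ _ c0) rate; near=> n.
have n0 : 0 < Num.sqrt (n%:R : R).
  by rewrite sqrtr_gt0 ltr0n; near: n; exact: nbhs_infty_gt.
have dge := right_derivative_ge cphi phi0 dphi (ltW (B0 n)).
have : `|0 - B n ^+ 2 * right_derivative phi (B n) / Num.sqrt n%:R| < derive1 phi 0.
  by near: n.
rewrite sub0r normrN => /(le_lt_trans (ler_norm _)).
rewrite ltr_pdivrMr// => lt.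
have B2 : 0 <= B n ^+ 2 by exact: sqr_ge0.
rewrite -(ler_pM2r c0) mulrC [leRHS]mulrC.
apply: ltW; apply: le_lt_trans lt; rewrite mulrC.
by rewrite ler_wpM2l.
Unshelve. all: by end_near. Qed.

Theorem corollary13
  (R : realType) (d : measure_display) (X : measurableType d)
  (phi : R -> R)
  (phi_ge0 : forall x, 0 <= phi x)
  (phi_convex : convex_function (setT : set R^o) phi)
  (phi0 : phi 0 = 1)
  (phi_ge_indic : forall x, \1_[set y : R | 0 <= y] x <= phi x)
  (phi_derivable0 : derivable phi 0 1)
  (phi_derive0_gt0 : 0 < derive1 phi 0)
  (Rs : set (X * X -> R)) (Rs_rules : forall r, Rs r -> ranking_rule r)
  (V : nat) (Rs_VC : has_VC_dimension (rule_sets Rs) V)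
  (rich : forall mu : probability (X * R)%type R,
     ereal_inf [set cost mu phi f | f in combinations Rs b] @[b --> +oo]
       --> optimal_cost mu phi)
  (B : nat -> R) (B_gt0 : forall n, 0 < B n)
  (B_infty : B n @[n --> \oo] --> +oo)
  (B_rate : (B n) ^+ 2 * right_derivative phi (B n) / Num.sqrt n%:R
              @[n --> \oo] --> (0 : R))
  (d' : measure_display) (Omega : measurableType d') (P : probability Omega R)
  (mu : probability (X * R)%type R)
  (D : nat -> {RV P >-> (X * R)%type}) (D_iid : iid mu D)
  (f : forall n, n.-tuple (X * R) -> X * X -> R)
  (f_measurable : forall n, measurable_fun setT
     (fun p : n.-tuple (X * R) * (X * X) => f n p.1 p.2))
  (f_min : forall n (s : n.-tuple (X * R)), (2 <= n)%N ->
     empirical_minimizer phi s (combinations Rs (B n)) (f n s)) :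
  {ae P, forall omega,
     risk mu (induced_rule (f n [tuple D i omega | i < n])) @[n --> \oo]
       --> optimal_risk mu}.
Proof.
have phi_cvx := convex_function_convexR phi_convex.
have Brate := rate_sqrt phi_cvx phi0 phi_derivable0 phi_derive0_gt0 B_gt0 B_rate.
pose S n w := sample_tuple D (fun i : 'I_n => i : nat) w.
have fin_cost : optimal_cost mu phi \is a fin_num by exact: optimal_cost_fin.
have fin_risk := optimal_risk_fin mu.
have f_in n (s : n.-tuple (X * R)) : (2 <= n)%N -> combinations Rs (B n) (f n s).
  by move=> n2; exact: empirical_minimizer_in (f_min n s n2).
have f_rule n (s : n.-tuple (X * R)) : (2 <= n)%N ->
    ranking_rule (induced_rule (f n s)).
  move=> n2; apply: ranking_rule_induced.
  by have [mf _] := combinations_bm Rs_rules (f_in n s n2).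
(* With [eta = 1 / (m + 1)] only countably many null sets arise. The lower bound on the risk is
   free, [optimal_risk] being an infimum. *)
suff eventually_near eta : 0 < eta -> {ae P, forall w, \forall n \near \oo,
    (risk mu (induced_rule (f n (S n w))) <= optimal_risk mu + eta%:E)%E}.
  have : {ae P, forall w, forall m : nat, \forall n \near \oo,
      (risk mu (induced_rule (f n (S n w))) <= optimal_risk mu + m.+1%:R^-1%:E)%E}.
    by apply: ae_foralln => m; exact: eventually_near.
  apply: filterS => w near_w.
  rewrite -(fineK fin_risk); apply: cvg_EFin.
    near=> n; rewrite ge0_fin_numE ?measure_ge0//.
    have n2 : (2 <= n)%N by near: n; exact: nbhs_infty_ge.
    by rewrite risk_mean ?ltry//; exact: f_rule.
  apply/cvgrPdist_le => e e0; near=> n.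
  have n2 : (2 <= n)%N by near: n; exact: nbhs_infty_ge.
  have rr : ranking_rule (induced_rule (f n (S n w))) by exact: f_rule.
  have lo : (optimal_risk mu <= risk mu (induced_rule (f n (S n w))))%E.
    by apply: ereal_inf_lbound; exists (induced_rule (f n (S n w))).
  pose m := Num.truncn e^-1.
  have hi : (risk mu (induced_rule (f n (S n w))) <= optimal_risk mu + m.+1%:R^-1%:E)%E.
    by near: n; exact: near_w.
  have me : m.+1%:R^-1 <= e.
    have ei : 0 <= e^-1 by rewrite invr_ge0 ltW.
    have /andP[_ /ltW lt] := truncn_itv ei.
    by rewrite -(invrK e) lef_pV2 ?posrE ?invr_gt0.
  rewrite /= -/(S n w); move: lo hi; rewrite (risk_mean mu rr).
  move: fin_risk; case: (optimal_risk mu) => // r _; rewrite /= -EFinD !lee_fin.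
  move=> lo hi; rewrite distrC ger0_norm ?subr_ge0//.
  by rewrite lerBlDl (le_trans hi)// lerD2l.
move=> eta0.
have [delta delta0 calib] := calibration mu phi_ge0 phi_cvx phi0
  phi_derivable0 phi_derive0_gt0 eta0.
(* Five errors of size at most [e] add up below [delta]: the deviation [Y1], the truncation, the
   slack [1 / n] of the minimizer, the deviation [Y2], and the distance of the cost of [g] to the
   optimum. *)
pose e := delta / 8; have e0 : 0 < e by rewrite divr_gt0.
have [T T0 tail] := cost_left_tail phi_ge0 phi_cvx e0.
(* [g] is chosen before [n], so the tail bound for a single kernel controls its empirical cost. *)
have [b b0 [g gR gcost]] : exists2 b, 0 < b & exists2 g, combinations Rs b g &
    (cost mu phi g < optimal_cost mu phi + e%:E)%E.
  have := rich mu; rewrite -{1}(fineK fin_cost) => /fine_cvgP[fin_near].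
  move=> /cvgrPdist_lt/(_ _ e0) dist_near.
  have : \forall b \near +oo, [/\ 0 < b,
      ereal_inf [set cost mu phi f | f in combinations Rs b] \is a fin_num &
      `|fine (optimal_cost mu phi) -
        fine (ereal_inf [set cost mu phi f | f in combinations Rs b])| < e].
    near=> b; split; near: b; last exact: dist_near; last exact: fin_near.
    by apply: nbhs_pinfty_gt; exact: num_real.
  move=> /filter_ex[b [b0 finb distb]]; exists b => //.
  have : (ereal_inf [set cost mu phi f | f in combinations Rs b] <
      optimal_cost mu phi + e%:E)%E.
    rewrite -(fineK finb) -(fineK fin_cost) -EFinD lte_fin.
    by move: distb; rewrite distrC => /(le_lt_trans (ler_norm _)); rewrite ltrBlDl.
  by move=> /ereal_inf_lt[_ [q qR <-] lt]; exists q.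
have bg := combinations_bm Rs_rules gR.
have bl := bm_margin_loss phi_ge0 phi_cvx bg.
pose Phi x := phi (trunc T x).
pose L := phi (T + 1) + phi (- T - 1); pose M := phi T + phi (- T).
have Phi_lip x y : `|Phi x - Phi y| <= L * `|x - y|.
  exact: truncated_cost_lipschitz.
have Phi_bnd x : 0 <= Phi x <= M.
  by rewrite phi_ge0/=; exact: truncated_cost_le.
have mPhi : measurable_fun setT Phi by exact: measurable_truncated_cost.
have M0 : 0 < M.
  have := convex_tangent phi_cvx phi0 phi_derivable0 T.
  have := phi_ge0 (- T); have : 0 < derive1 phi 0 * T by rewrite mulr_gt0.
  by rewrite /M; lra.
have [Mg Mg_bnd] := bl.2.
pose Mg' := `|Mg| + 1; have Mg'0 : 0 < Mg' by rewrite ltr_wpDl.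
pose hf n t := margin_loss Phi (f n t).
have bhf n := bm_joint_margin_loss Phi_bnd mPhi (f_measurable n).
pose Y1 n w := \int[(mu \x mu)%E]_z hf n (S n w) z - ustat (hf n (S n w)) (S n w).
pose Y2 n w := ustat (margin_loss phi g) (S n w) - \int[(mu \x mu)%E]_z margin_loss phi g z.
have bY1 n : bounded_measurable (Y1 n).
  by apply: bmB; [exact: (bm_mean_sample mu D (bhf n))|exact: (bm_ustat_sample D (bhf n))].
have bY2 n : bounded_measurable (Y2 n).
  apply: bmB; last exact: bm_cst.
  apply: (bm_ustat_sample D (h := fun _ : n.-tuple (X * R) => margin_loss phi g)).
  exact: (bm_comp bl measurable_snd).
have mgt (Y : Omega -> R) : bounded_measurable Y -> measurable [set w | e < Y w].
  move=> [mY _]; rewrite (_ : [set w | _] = Y @^-1` `]e, +oo[); last first.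
    by apply/seteqP; split=> w /=; rewrite in_itv/= andbT.
  by rewrite -[X in measurable X]setTI; exact: mY.
have ev1 : {ae P, forall w, \forall n \near \oo, ~ (e < Y1 n w)}.
  pose kappa := e ^+ 2 / (128 * M ^+ 2).
  have kappa0 : 0 < kappa by rewrite divr_gt0 ?mulr_gt0 ?exprn_gt0.
  apply: (@borel_cantelli_expR _ _ _ P (fun n => [set w | e < Y1 n w]) (kappa / 2)).
  - by rewrite divr_gt0.
  - by move=> n; exact: mgt.
  have C0 : 0 <= 16 * L ^+ 2 / e ^+ 2 by rewrite divr_ge0 ?sqr_ge0// mulr_ge0// sqr_ge0.
  near=> n; have n2 : (2 <= n)%N by near: n; exact: nbhs_infty_ge.
  have [k k0 [kC le]] : exists2 k, (0 < k)%N & 16 * L ^+ 2 / e ^+ 2 * B n ^+ 2 <= k%:R /\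
    expR (- (n%:R * kappa)) * (2 * ((4 * n ^ 2 + 1) ^ V)%:R) ^+ k <=
    expR (- (n%:R * (kappa / 2))).
    by near: n; exact: class_tail_summable.
  apply: (@le_trans _ _ (expR (- (n%:R * kappa)) * (2 * ((4 * n ^ 2 + 1) ^ V)%:R) ^+ k)%:E).
    apply: (class_tail D_iid Rs_rules Rs_VC Phi_lip Phi_bnd M0 mPhi n2 k0 e0 (B_gt0 n)) => //.
    + by move: kC; rewrite mulrAC ler_pdivrMr ?exprn_gt0// (mulrC k%:R).
    + by move=> t; exact: f_in.
  by rewrite lee_fin.
have ev2 : {ae P, forall w, \forall n \near \oo, ~ (e < Y2 n w)}.
  apply: (@borel_cantelli_expR _ _ _ P (fun n => [set w | e < Y2 n w])
    (e ^+ 2 / (32 * Mg' ^+ 2))).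
  - by rewrite divr_gt0 ?mulr_gt0 ?exprn_gt0.
  - by move=> n; exact: mgt.
  near=> n; have n2 : (2 <= n)%N by near: n; exact: nbhs_infty_ge.
  apply: (ustat_tail D_iid n2 Mg'0 e0 bl.1) => z; rewrite /margin_loss phi_ge0/=.
  rewrite (le_trans (ler_norm _))// (le_trans (Mg_bnd z))//.
  by rewrite (le_trans (ler_norm _))// lerDl.
apply: filterS2 ev1 ev2 => w near1 near2.
near=> n; have n2 : (2 <= n)%N by near: n; exact: nbhs_infty_ge.
set s := S n w.
have Y1n : Y1 n w <= e by rewrite leNgt; apply/negP; near: n.
have Y2n : Y2 n w <= e by rewrite leNgt; apply/negP; near: n.
(* From such [n] on, [g] also belongs to the class of weight [B n] and competes with [f n s]. *)
have bB : b <= B n by near: n; move/cvgryPge : B_infty; exact.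
have ne : n%:R^-1 <= e.
  have nr : 0 < n%:R :> R by rewrite ltr0n ltnW.
  rewrite -(invrK e) lef_pV2 ?posrE ?invr_gt0//.
  by near: n; exact: nbhs_infty_ger.
pose q y := trunc T (f n s y).
have bf := combinations_bm Rs_rules (f_in n s n2).
have bq : bounded_measurable q.
  split; last first.
    exists T => y; have := trunc_in (f n s y) (ltW T0).
    by rewrite ler_norml.
  apply: (measurableT_comp (f := trunc T)) bf.1.
  by apply: measurable_maxr => //; exact: measurable_minr.
rewrite -(induced_rule_trunc (f n s) T0); apply: calib => //.
have lossE : margin_loss phi q = hf n s by rewrite /hf margin_loss_trunc// ltW.
rewrite cost_mean// lossE.
have gcost' : \int[(mu \x mu)%E]_p margin_loss phi g p < fine (optimal_cost mu phi) + e.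
  by move: gcost; rewrite cost_mean// -{1}(fineK fin_cost) -EFinD lte_fin.
rewrite -(fineK fin_cost) -EFinD lee_fin.
have U1 : ustat (hf n s) s <= empirical_cost phi s (f n s) + e.
  rewrite empirical_cost_ustat -(ustat_weight_sum e n2) -mulrDr.
  apply: ler_wpM2l; first exact: ustat_weight_ge0.
  rewrite -big_split/=; apply: ler_sum => i _.
  rewrite -big_split/=; apply: ler_sum => j _.
  apply: truncated_cost_le_cost => //; first exact: ltW.
  by move=> t Tt; exact: tail.
have U2 : empirical_cost phi s (f n s) <= ustat (margin_loss phi g) s + n%:R^-1.
  apply: (empirical_minimizer_le phi_ge0 (f_min n s n2)).
  exact: combinations_le gR.
move: Y1n Y2n; rewrite /Y1 /Y2 -/s => Y1n Y2n.
have : delta = 8 * e by rewrite /e mulrC divfK.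
lra.
Unshelve. all: by end_near. Qed.
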